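(* Let $A,B,C,D$ be the consecutive vertices of a convex quadrilateral and let $V$ be the intersection point of its diagonals $AC$ and $BD$. Assume that either (a) the supporting lines of $AB$ and $CD$ meet at a point $O$ such that $B$ lies strictly between $O$ and $A$ and $C$ lies strictly between $O$ and $D$, or (b) $AB$ and $CD$ are parallel, at distance $d$ between their supporting lines. Let $\vec u=\frac{B-A}{|B-A|}$, let $op(M)$, for $M$ in the segment $AB$, be the point of the segment $CD$ such that the line through $M$ and $op(M)$ contains $V$, and for $0<a<|B-A|$ write $$\rho_2'(\ell)=\rho'_2\big(A+a\vec u,\,A+a\vec u,\,C,\,op(A+a\vec u);\ell\big)=\lim_{t\to0^+}\frac1t\,\rho\big(A+a\vec u,\,A+(a+t)\vec u,\,C,\,op(A+a\vec u);\ell\big).$$ Then, for almost every $\ell>0$ and almost every $a$, the following holds. In case (a), let $\gamma=\angle AOD$, $x=|O-(A+a\vec u)|$, $y_1=|OC|$, $y_2=|O-op(A+a\vec u)|$. If $\ell<x\sin\gamma$ then $\rho_2'(\ell)=0$, and if $\ell>x\sin\gamma$ then $$\rho'_2(\ell)=1_{[y_1,y_2]}(y_-)\frac{x\sin\gamma}{\ell\sqrt{\ell^2-x^2\sin^2\gamma}}\sin\Big(\arcsin\big(\tfrac{x}{\ell}\sin\gamma\big)-\gamma\Big)+1_{[y_1,y_2]}(y_+)\frac{x\sin\gamma}{\ell\sqrt{\ell^2-x^2\sin^2\gamma}}\sin\Big(\arcsin\big(\tfrac{x}{\ell}\sin\gamma\big)+\gamma\Big),$$ where $$y_\pm=\frac{\sin\big(\arcsin(\frac{x}{\ell}\sin\gamma)\pm\gamma\big)}{\sin\gamma}\,\ell.$$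 In case (b), let $x,y_1,y_2$ be the coordinates of $A+a\vec u$, $C$ and $op(A+a\vec u)$, respectively, along the common direction $\frac{A-B}{|A-B|}$ of the two lines, the origin being at $B$ on the line $AB$ and at the orthogonal projection of $B$ on the line $CD$. If $\ell<d$ then $\rho'_2(\ell)=0$, and if $\ell>d$ then $$\rho_2'(\ell)=\Big(1_{[y_1,y_2]}(y_-)+1_{[y_1,y_2]}(y_+)\Big)\frac{d^2}{\ell^2\sqrt{\ell^2-d^2}},\qquad y_\pm=x\pm\sqrt{\ell^2-d^2}.$$
   Context: $\mu$ is the translation- and rotation-invariant measure on straight lines of the plane, normalized as $d\mu=dp\,d\theta$ ($\theta\in[0,\pi)$ the direction of the line, $p$ its signed distance to the origin). A chord joining two segments is the piece of a straight line meeting both segments comprised between its intersection points with them; its length is the distance between those two points, and sets of chords carry the measure $\mu$ of the corresponding lines. For points $P,P',Q,Q'$, $\rho(P,P',Q,Q';\ell)$ denotes the density of measure of the length of the chords joining the segments $PP'$ and $QQ'$: the function of $\ell$ whose integral over any Borel set $E\subset(0,\infty)$ is the $\mu$-measure of the set of such chords with length in $E$; it is taken to be the version continuous in $\ell\in(0,\infty)$, or continuous on $(0,\infty)\setminus\{d\}$ if the segments are parallel with supporting lines at distance $d$. $1_{[y_1,y_2]}$ is the indicator function of the interval $[y_1,y_2]$; $\arcsin$ takes values in $[-\pi/2,\pi/2]$. *)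

(* Defs.v *)
From HB Require Import structures.
From mathcomp Require Import all_boot all_order all_algebra.
From mathcomp Require Import all_classical all_reals all_analysis.

Set Implicit Arguments.
Unset Strict Implicit.
Unset Printing Implicit Defensive.

Import Order.TTheory GRing.Theory Num.Theory.
Import numFieldNormedType.Exports.

Local Open Scope classical_set_scope.
Local Open Scope ring_scope.

Section PlaneGeometry.
Context {R : realType}.
Implicit Types (A B C D O P Q X Y u : R * R).

(* The library norm on R * R is the sup norm, hence an explicit Euclidean one. *)
Definition dot P Q : R := P.1 * Q.1 + P.2 * Q.2.
Definition cross P Q : R := P.1 * Q.2 - P.2 * Q.1.
Definition eucl_norm P : R := Num.sqrt (dot P P).
Definition eucl_dist P Q : R := eucl_norm (Q - P).

Definition segment P Q : set (R * R) :=
  [set X | exists t : R, 0 <= t <= 1 /\ X = P + t *: (Q - P)].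

Definition strictly_between P Q : set (R * R) :=
  [set X | exists t : R, 0 < t < 1 /\ X = P + t *: (Q - P)].

Definition line_through P Q : set (R * R) :=
  [set X | exists t : R, X = P + t *: (Q - P)].

Definition set_dist (S T : set (R * R)) : R :=
  inf [set r | exists X Y, S X /\ T Y /\ r = eucl_dist X Y].

Definition parallel P P' Q Q' : Prop := cross (P' - P) (Q' - Q) = 0.

Definition angle P O Q : R :=
  acos (dot (P - O) (Q - O) / (eucl_norm (P - O) * eucl_norm (Q - O))).

Definition strict_same_side P Q X Y : Prop :=
  0 < cross (Q - P) (X - P) * cross (Q - P) (Y - P).

(* The line supporting any side leaves the two other vertices strictly on one
   side of it. *)
Definition convex_quadrilateral A B C D : Prop :=
  [/\ strict_same_side A B C D, strict_same_side B C D A,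
      strict_same_side C D A B & strict_same_side D A B C].

(* z = (p, theta): the line of direction (cos theta, sin theta) whose signed
   distance to the origin, along the normal (- sin theta, cos theta), is p. *)
Definition straight_line (z : R * R) : set (R * R) :=
  [set X | cos z.2 * X.2 - sin z.2 * X.1 = z.1].

(* d mu = dp dtheta, with 0 <= theta < pi. *)
Definition line_measure (S : set (set (R * R))) : \bar R :=
  (lebesgue_measure \x lebesgue_measure)%E
    [set z : measurableTypeR R * measurableTypeR R |
      (0 <= z.2 < pi) /\ S (straight_line z)].

(* The lines carrying a chord that joins PP' and QQ' with length in E.  The
   existential quantifiers over M and N are harmless: the intersection points
   are unique except for lines containing one of the segments, which form a
   mu-null set. *)
Definition chords P P' Q Q' (E : set R) : set (set (R * R)) :=
  [set L | exists M N, [/\ segment P P' M, segment Q Q' N, L M, L N &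
                           E (eucl_dist M N)]].

Definition chord_length_density P P' Q Q' (f : R -> R) : Prop :=
  measurable_fun (`]0, +oo[ : set (measurableTypeR R)) f /\
  forall E : set (measurableTypeR R), measurable E -> E `<=` `]0, +oo[ ->
    (\int[lebesgue_measure]_(l in E) (f l)%:E)%E
      = line_measure (chords P P' Q Q' E).

Definition continuous_version P P' Q Q' (f : R -> R) : Prop :=
  forall l : R, 0 < l ->
    ~ (parallel P P' Q Q' /\
       l = set_dist (line_through P P') (line_through Q Q')) ->
    {for l, continuous f}.

(* Default value 0 when there is no such density; when there is one, it is
   unique at every l > 0, except the distance between the two supporting lines
   if the segments are parallel. *)
Definition rho P P' Q Q' : R -> R :=
  xget (fun=> 0) [set f | chord_length_density P P' Q Q' f /\
                          continuous_version P P' Q Q' f].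

Definition rho2_quotient A u (a : R) Q Q' (l t : R) : R :=
  t^-1 * rho (A + a *: u) (A + (a + t) *: u) Q Q' l.

(* Meaningful when the limit exists. *)
Definition rho2' A u (a : R) Q Q' (l : R) : R :=
  lim (rho2_quotient A u a Q Q' l t @[t --> 0^'+]).

Definition rho2'_is A u (a : R) Q Q' (l v : R) : Prop :=
  cvg (rho2_quotient A u a Q Q' l t @[t --> 0^'+]) /\ rho2' A u a Q Q' l = v.

Definition lines_meet_beyond_BC A B C D O : Prop :=
  [/\ line_through A B O, line_through C D O,
      strictly_between O A B & strictly_between O D C].

End PlaneGeometry.

(* Main.v *)
Require Import Defs.
From HB Require Import structures.
From mathcomp Require Import all_boot all_order all_algebra.
From mathcomp Require Import all_classical all_reals all_analysis measurable_realfun.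
From mathcomp Require Import ring lra.
Set Implicit Arguments.
Unset Strict Implicit.
Unset Printing Implicit Defensive.
Import Order.TTheory GRing.Theory Num.Theory.
Import numFieldNormedType.Exports.
Local Open Scope classical_set_scope.
Local Open Scope ring_scope.

(** The density of the lengths of the chords between a segment [PP'] of [AB] and
    a segment [QQ'] of [CD] is computed explicitly, and then differentiated with
    respect to the length of [PP'].  It is obtained by cutting the measure of
    lines along the directions: for a fixed direction the lines are parametrized
    by their distance [p] to the origin, and the directions may be measured from
    any reference, in either sense ([line_measure_polar]).

    If the lines [AB] and [CD] meet at [O] with an angle [ga], the chords in a
    given direction [b], measured from [OD], are sides of homothetic triangles.
    By the law of sines a chord of length [l] has its ends at the distances
    [l sin b / sin ga] and [l sin (b - ga) / sin ga] of [O], and it lies at the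
    distance [l sin b sin (b - ga) / sin ga] of [O].  So [p] is linear in [l],
    and the density at [l] is the integral over [b] of
    [sin b sin (b - ga) / sin ga], restricted to the directions for which both
    ends belong to the segments ([line_measure_wedge]).  Since the integrand is
    bounded, the density is continuous.  When the first segment shrinks to
    [[x - t, x]], there remain two thin ranges of directions, next to
    [asin (x sin ga / l)] and next to its supplement.  The derivatives at
    [t = 0] of the integrals over these ranges are the two terms of the formula
    ([cvg_wedge_density_gt]).

    If the lines are parallel at the distance [d], the length [d / sin b] of a
    chord depends on its direction only, and the lines of this direction are
    measured by the set of the possible first ends.  The substitution
    [l = d / sin b] ([strip_substitution]) gives the density as
    [d^2 / (l^2 sqrt (l^2 - d^2))] times the measure of the first ends [x] such
    that [x + sqrt (l^2 - d^2)] or [x - sqrt (l^2 - d^2)] belongs to the second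
    segment, counted separately ([line_measure_strip]).  For first ends in
    [[x - t, x]] each of these two measures is eventually [t] or [0].

    Two densities agree wherever both are continuous, so these formulas do give
    [rho] ([rho_eq]).  The limits hold unless an end of the second segment is at
    the distance [l] of the point [A + a u].  This excludes two lengths for each
    [a], and they are measurable functions of [a], because the position of
    [op (A + a u)] is a rational function of [a] ([op_coef]).  By Fubini these
    pairs [(l, a)] form a null set ([ae_not_extremal_chord]). *)

(** * Affine changes of variable and periodic functions *)

Section affine.
Context {R : realType}.
Notation mu := (@lebesgue_measure R).

Lemma measurable_affine (k o : R) :
  measurable_fun [set: measurableTypeR R]
    ((fun x : R => k * x + o) : measurableTypeR R -> measurableTypeR R).
Proof. by do 2 apply: measurable_funD => //; apply: measurable_funM. Qed.

(** Both sides are measures in [B], so it suffices to compare them on half-open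
    intervals. *)
Lemma lebesgue_measure_affine (k o : R) (B : set (measurableTypeR R)) :
  k != 0 -> measurable B ->
  (mu B = `|k|%:E * mu ((fun x : R => k * x + o)%R @^-1` B))%E.
Proof.
move=> k0 mB.
pose f : measurableTypeR R -> measurableTypeR R := fun x => k * x + o.
have [nu nuE] : exists nu : {measure set (measurableTypeR R) -> \bar R},
    forall A, nu A = pushforward mu f A.
  by unshelve eexists (pushforward mu f); [exact: measurable_affine|].
pose K : {nonneg R} := NngNum (normr_ge0 k).
transitivity (mscale K nu B); last by rewrite /= /mscale nuE.
apply: lebesgue_measure_unique mB => _ [[a b] ab <-].
rewrite /= /mscale nuE /pushforward /=.
have [kp|kn|kz] := ltgtP 0 k; last by rewrite -kz eqxx in k0.
  have -> : (f @^-1` [set` Interval (BRight a) (BRight b)]) = `](a-o)/k, (b-o)/k]%classic.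
    by apply/seteqP; split => x /=; rewrite /f !in_itv/= ltr_pdivrMr// ler_pdivlMr//
      mulrC; lra.
  rewrite !lebesgue_measure_itv/= !lte_fin ltr_pM2r ?invr_gt0// ltrD2r ger0_norm ?ltW//.
  case: ifPn => _; last by rewrite mule0.
  by rewrite -!EFinB -EFinM; congr EFin; field.
have -> : (f @^-1` [set` Interval (BRight a) (BRight b)]) = `[(b-o)/k, (a-o)/k[%classic.
  by apply/seteqP; split => x /=; rewrite /f !in_itv/= ler_ndivrMr// ltr_ndivlMr//
    mulrC; lra.
rewrite !lebesgue_measure_itv/= !lte_fin ltr_nM2r ?invr_lt0// ltrD2r ltr0_norm//.
case: ifPn => _; last by rewrite mule0.
by rewrite -!EFinB -EFinM; congr EFin; field; rewrite lt_eqF.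
Qed.

Lemma ge0_integral_affine (k o : R) (h : measurableTypeR R -> \bar R) :
  k != 0 -> measurable_fun setT h -> (forall x, 0 <= h x)%E ->
  (\int[mu]_x h x = `|k|%:E * \int[mu]_x h (k * x + o)%R)%E.
Proof.
move=> k0 mh h0.
pose f : measurableTypeR R -> measurableTypeR R := fun x => k * x + o.
pose K : {nonneg R} := NngNum (normr_ge0 k).
have mf : measurable_fun setT f by exact: measurable_affine.
have [nu nuE] : exists nu : {measure set (measurableTypeR R) -> \bar R},
    nu = pushforward mu f :> (set _ -> _).
  by unshelve eexists (pushforward mu f).
transitivity (\int[mscale K nu]_x h x)%E.
  apply: eq_measure_integral => //= A mA _.
  by rewrite (lebesgue_measure_affine o k0 mA) /mscale nuE.
rewrite ge0_integral_mscale//= nuE; congr (_ * _)%E.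
by rewrite (ge0_integral_pushforward mf) ?preimage_setT.
Qed.

End affine.

Section periodic.
Context {R : realType}.
Notation mu := (@lebesgue_measure R).
Implicit Types h : measurableTypeR R -> \bar R.

Lemma ge0_integral_affine_set (k o : R) (D : set (measurableTypeR R)) h :
  k != 0 -> measurable D -> measurable_fun setT h -> (forall x, D x -> 0 <= h x)%E ->
  (\int[mu]_(x in D) h x =
   `|k|%:E * \int[mu]_(x in ((fun x : R => k * x + o)%R @^-1` D))
     h (k * x + o)%R)%E.
Proof.
move=> k0 mD mh h0.
rewrite integral_mkcond (ge0_integral_affine o k0); last 2 first.
- by apply/(measurable_restrictT _ _).1 => //; exact: measurable_funS mh.
- exact: erestrict_ge0.
by rewrite [in RHS]integral_mkcond.
Qed.

Lemma periodic_intmul (f : R -> \bar R) (T : R) (m : int) :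
  (forall x, f (x + T) = f x) -> forall x, f (x + m%:~R * T) = f x.
Proof.
move=> fT; have fTn n x : f (x + n%:R * T) = f x.
  elim: n x => [|n IHn] x; first by rewrite mul0r addr0.
  by rewrite -[in RHS]IHn -[in RHS]fT -addrA -natr1 mulrDl mul1r.
case: m => n x; first by rewrite fTn.
rewrite NegzE mulrNz mulNr -(fTn n.+1) -addrA; congr f.
by rewrite -pmulrn addNr addr0.
Qed.

(** A translation by a multiple of the period brings [c] into [[0, T[]; the part
    of the interval that lies beyond [T] is then translated back by one period. *)
Lemma ge0_integral_periodic (T : R) h (c : R) : 0 < T ->
  measurable_fun setT h -> (forall x, 0 <= h x)%E ->
  (forall x : R, h (x + T) = h x) ->
  (\int[mu]_(x in `[c, (c + T)%R[) h x = \int[mu]_(x in `[0%R, T[) h x)%E.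
Proof.
move=> T0 mh h0 hT.
pose m : int := Num.floor (c / T); pose r := c - m%:~R * T.
have /andP[m1 m2] := floor_itv (c / T).
have r0 : 0 <= r by rewrite /r subr_ge0 -ler_pdivlMr.
have rT : r < T.
  by move: m2; rewrite intrD ltr_pdivrMr// mulrDl mul1r /r -/m; lra.
have mhS D : measurable D -> measurable_fun D h.
  by move=> mD; exact: measurable_funS mh.
rewrite (@ge0_integral_affine_set 1 (m%:~R * T))// ?oner_neq0// normr1 mul1e.
have -> : (fun x : R => 1 * x + m%:~R * T) @^-1` `[c, c + T[ = `[r, r + T[%classic.
  by apply/seteqP; split => x /=; rewrite !in_itv/= mul1r /r; lra.
under eq_integral do rewrite mul1r periodic_intmul//.
have split1 : (`[r, r + T[ = `[r, T[ `|` `[T, r + T[)%classic.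
  apply/seteqP; split => x /=; rewrite !in_itv/=; last by move=> [xx|xx]; lra.
  by move=> xx; have [?|?] := ltP x T; [left|right]; lra.
have split2 : (`[0, T[ = `[0, r[ `|` `[r, T[)%classic.
  apply/seteqP; split => x /=; rewrite !in_itv/=; last by move=> [xx|xx]; lra.
  by move=> xx; have [?|?] := ltP x r; [left|right]; lra.
rewrite split1 split2 !ge0_integral_setU//; last 4 first.
- by apply: mhS; exact: measurableU.
- by apply/disj_setPS => x [] /=; rewrite !in_itv/=; lra.
- by apply: mhS; exact: measurableU.
- by apply/disj_setPS => x [] /=; rewrite !in_itv/=; lra.
rewrite [LHS]addeC; congr (_ + _)%E.
rewrite (@ge0_integral_affine_set 1 T)// ?oner_neq0// normr1 mul1e.
have -> : (fun x : R => 1 * x + T) @^-1` `[T, r + T[ = `[0, r[%classic.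
  by apply/seteqP; split => x /=; rewrite !in_itv/= mul1r; lra.
by apply: eq_integral => x _; rewrite mul1r hT.
Qed.

(** With [T = pi], the directions of unoriented lines may be measured from any
    reference direction and in either sense. *)
Lemma ge0_integral_periodic_affine (T : R) h (k c : R) : 0 < T -> `|k| = 1 ->
  measurable_fun setT h -> (forall x, 0 <= h x)%E ->
  (forall x : R, h (x + T) = h x) ->
  (\int[mu]_(x in `[0%R, T[) h (k * x + c)%R = \int[mu]_(x in `[0%R, T[) h x)%E.
Proof.
move=> T0 k1 mh h0 hT.
have mhS D : measurable D -> measurable_fun D h.
  by move=> mD; exact: measurable_funS mh.
have k0 : k != 0 by rewrite -normr_eq0 k1 oner_neq0.
have [kp|kn] := ltP 0 k.
  have {k0}k1 : k = 1 by rewrite -k1 gtr0_norm.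
  rewrite -(@ge0_integral_periodic T h c)//.
  rewrite [RHS](@ge0_integral_affine_set 1 c)// ?oner_neq0// normr1 mul1e k1.
  congr (integral mu _ _).
  by apply/seteqP; split => x /=; rewrite !in_itv/= mul1r; lra.
have {k0}k1 : k = -1 by rewrite -k1 ler0_norm// opprK.
rewrite -(@ge0_integral_periodic T h (c - T))// subrK.
rewrite [RHS]integral_itv_bndo_bndc; last exact: mhS.
rewrite -[RHS]integral_itv_obnd_cbnd; last exact: mhS.
rewrite [RHS](@ge0_integral_affine_set (-1) c)// ?oppr_eq0 ?oner_neq0//.
rewrite normrN normr1 mul1e k1.
congr (integral mu _ _).
by apply/seteqP; split => x /=; rewrite !in_itv/= mulN1r; lra.
Qed.

Lemma product_lebesgueE (A : set (measurableTypeR R * measurableTypeR R)) :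
  measurable A -> ((mu \x mu) A = \int[mu]_y mu (ysection A y))%E.
Proof.
move=> mA; have := indic_fubini_tonelli mu mu mA.
by rewrite indic_fubini_tonelli_FE// indic_fubini_tonelli_GE.
Qed.

End periodic.

(** * The measure of lines in polar coordinates *)

Section polar.
Context {R : realType}.
Notation mu := (@lebesgue_measure R).

Lemma straight_line_half_turn (p t k : R) : `|k| = 1 ->
  straight_line (p, t + k * pi) = straight_line (- p, t).
Proof.
move=> k1.
have [ck sk] : cos (t + k * pi) = - cos t /\ sin (t + k * pi) = - sin t.
  have [kp|kn] := ltP 0 k.
    by rewrite -(gtr0_norm kp) k1 mul1r cosDpi sinDpi.
  rewrite -[k]opprK -(ler0_norm kn) k1 mulN1r; split.
    by rewrite -[t in RHS](subrK pi) cosDpi opprK.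
  by rewrite -[t in RHS](subrK pi) sinDpi opprK.
rewrite /straight_line; apply/seteqP; split => X /=; rewrite ck sk; lra.
Qed.

(** The directions [t] and [t + pi] give the same lines, up to the sign of [p].
    Hence the measure of a section is [pi]-periodic in the direction, and
    [(p, t)] can be replaced by [(q, b)] where [p = o b + s q] and
    [t = c + k b].  The function [o] chooses the origin of [q] in each direction:
    in what follows, the line through a fixed point. *)
Lemma line_measure_polar (S : set (set (R * R))) (c k s : R) (o : R -> R)
    (T : set (measurableTypeR R * measurableTypeR R)) :
  `|k| = 1 -> `|s| = 1 ->
  measurable_fun setT (o : measurableTypeR R -> measurableTypeR R) ->
  measurable T ->
  (forall q b, S (straight_line (o b + s * q, c + k * b)) <-> T (q, b)) ->
  (line_measure S = \int[mu]_(b in `[0%R, pi[) mu (ysection T b))%E.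
Proof.
move=> k1 s1 mo mT ST.
have kk : k * k = 1 by rewrite -expr2 -real_normK ?num_real// k1 expr1n.
have ss : s * s = 1 by rewrite -expr2 -real_normK ?num_real// s1 expr1n.
have k0 : k != 0 by rewrite -normr_eq0 k1 oner_neq0.
have s0 : s != 0 by rewrite -normr_eq0 s1 oner_neq0.
pose psi b := mu (ysection T b).
have mpsi : measurable_fun setT psi by exact: measurable_fun_ysection.
have E q X : s * (-1 * q + - s * X) = - (s * q) - X.
  have -> : s * (-1 * q + - s * X) = - (s * q) - s * s * X by ring.
  by rewrite ss mul1r.
have psi_pi b : psi (b + pi) = psi b.
  rewrite /psi (@lebesgue_measure_affine R (-1) (- s * (o b + o (b + pi))) (ysection T b)).
  - rewrite normrN normr1 mul1e; congr (mu _).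
    apply/seteqP; split => q /=; rewrite /ysection/= !inE -!ST
      [k * (b + pi)]mulrDr [c + (_ + _)]addrA straight_line_half_turn// => Sq; congr (S (straight_line (_, _))): Sq;
      rewrite E; lra.
  - by rewrite oppr_eq0 oner_neq0.
  - exact: measurable_ysection.
pose g (z : measurableTypeR R * measurableTypeR R) :
    measurableTypeR R * measurableTypeR R :=
  (s * z.1 - s * o (k * z.2 - k * c), k * z.2 - k * c).
have mg2 : measurable_fun setT (fun z => (g z).2 : measurableTypeR R).
  by rewrite /g/=; apply: measurable_funD => //; apply: measurable_funM.
have mg : measurable_fun setT g.
  apply: measurable_fun_pair => //.
  apply: measurable_funB; first by apply: measurable_funM.
  by apply: measurable_funM => //; exact: (measurableT_comp mo mg2).
pose A := [set z : measurableTypeR R * measurableTypeR R |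
  (0 <= z.2 < pi) /\ S (straight_line z)].
have AE : A = (setT `*` `[0, pi[) `&` g @^-1` T.
  apply/seteqP; split => [[p t]|[p t]] /=.
    rewrite in_itv/= => -[tp StT]; split => //; rewrite /g/= -ST.
    by congr (S (straight_line (_, _))): StT; rewrite !mulrBr !mulrA ?kk ?ss; lra.
  rewrite in_itv/= => -[[_ tp]]; rewrite /g/= -ST => StT; split => //.
  by congr (S (straight_line (_, _))): StT; rewrite !mulrBr !mulrA ?kk ?ss; lra.
rewrite /line_measure -/A.
have mA : measurable A.
  rewrite AE; apply: measurableI; first exact: measurableX.
  by rewrite -[X in measurable X]setTI; exact: mg.
rewrite product_lebesgueE//.
rewrite -(ge0_integral_periodic_affine (k := k) (- (k * c)))//; last exact: pi_gt0.
rewrite [RHS]integral_mkcond; apply: eq_integral => t _.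
rewrite patchE; case: ifPn => [tpi|tpi].
  rewrite /psi [RHS](@lebesgue_measure_affine R s (- s * o (k * t - k * c)))//; last first.
    exact: measurable_ysection.
  rewrite s1 mul1e; congr (mu _).
  rewrite inE/= in_itv/= in tpi.
  apply/seteqP; split => p /=; rewrite /ysection/= !inE AE/= in_itv/= /g/= mulNr; tauto.
rewrite [X in mu X](_ : _ = set0) ?measure0//.
rewrite notin_setE/= in_itv/= in tpi.
by apply/seteqP; split => p //=; rewrite /ysection/= inE AE/= in_itv/=; tauto.
Qed.

End polar.

(** * Uniqueness of the density at its points of continuity *)

Section uniqueness.
Context {R : realType}.
Notation mu := (@lebesgue_measure R).
Implicit Types (P Q : R * R) (f g : R -> R).

Lemma integrable_cst_finite (D : set (measurableTypeR R)) (c : R) :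
  measurable D -> (mu D < +oo)%E -> mu.-integrable D (EFin \o cst c).
Proof.
move=> mD Dfin; apply/integrableP; split; first by apply/measurable_EFinP.
by rewrite (integral_cst mu mD `|c|%:E) lte_mul_pinfty.
Qed.

(** If [g l < f l], a positive gap remains on a small interval around [l], whereas
    the two integrals over this interval measure the same set of lines. *)
Lemma chord_length_density_le P P' Q Q' f g (l : R) : 0 < l ->
  chord_length_density P P' Q Q' f -> chord_length_density P P' Q Q' g ->
  {for l, continuous f} -> {for l, continuous g} -> f l <= g l.
Proof.
move=> l0 [mf fE] [mg gE] cf cg; rewrite leNgt; apply/negP => gf.
pose e := (f l - g l) / 3.
have e0 : 0 < e by rewrite /e; lra.
have : \forall x \near l, [/\ 0 < x, `|f l - f x| < e & `|g l - g x| < e].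
  near=> x; split.
  - by near: x; exact: lt_nbhsr.
  - by near: x; move/cvgrPdist_lt : cf; exact.
  - by near: x; move/cvgrPdist_lt : cg; exact.
case=> r /= r0 lr.
pose E := `[l - r / 2, l + r / 2]%classic : set (measurableTypeR R).
have mE : measurable E by exact: measurable_itv.
have rE x : E x -> [/\ 0 < x, `|f l - f x| < e & `|g l - g x| < e].
  rewrite /E/= in_itv/= => /andP[x1 x2]; apply: lr => /=.
  by rewrite ltr_distlC; apply/andP; split; lra.
have Epos : E `<=` `]0, +oo[ by move=> x /rE[x0 _ _]; rewrite /= in_itv/= x0.
have muE : mu E = r%:E.
  rewrite /E lebesgue_measure_itv/= lte_fin ifT; last by lra.
  by rewrite -EFinB; congr EFin; lra.
have bint (h : R -> R) (c : R) : measurable_fun (`]0, +oo[ : set (measurableTypeR R)) h ->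
    (forall x, E x -> `|c - h x| < e) -> mu.-integrable E (EFin \o h).
  move=> mh hc; apply: (@le_integrable _ _ _ _ _ mE _ (EFin \o cst (`|c| + e))).
  - by apply/measurable_EFinP; exact: measurable_funS mh.
  - move=> x /hc hx /=; rewrite lee_fin.
    rewrite (le_trans _ (ler_norm _))// -[h x](subKr c).
    by rewrite (le_trans (ler_normB _ _))// lerD2l ltW.
  - by apply: integrable_cst_finite => //; rewrite muE ltry.
have Ef : (\int[mu]_(x in E) (EFin \o cst (f l - e)%R) x <= \int[mu]_(x in E) (f x)%:E)%E.
  apply: le_integral => //.
  - by apply: integrable_cst_finite => //; rewrite muE ltry.
  - by apply: (bint f (f l)) => // x /rE[].
  - by move=> x; rewrite inE lee_fin /= => /rE[_ fx _]; move: fx; rewrite ltr_norml; lra.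
have Eg : (\int[mu]_(x in E) (g x)%:E <= \int[mu]_(x in E) (EFin \o cst (g l + e)%R) x)%E.
  apply: le_integral => //.
  - by apply: (bint g (g l)) => // x /rE[].
  - by apply: integrable_cst_finite => //; rewrite muE ltry.
  - by move=> x; rewrite inE lee_fin /= => /rE[_ _ fx]; move: fx; rewrite ltr_norml; lra.
have := le_trans Ef (le_trans _ Eg).
have Ic c : (\int[mu]_(x in E) (EFin \o cst c) x = (c * r)%:E)%E.
  rewrite EFinM -muE; exact: (integral_cst mu mE c%:E).
rewrite fE// gE// !Ic lee_fin => /(_ (lexx _)).
by rewrite ler_pM2r// /e; lra.
Unshelve. all: by end_near. Qed.

(** The density [rho] is defined by choice; this is how it gets computed. *)
Lemma rho_eq P P' Q Q' f (l : R) : 0 < l ->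
  chord_length_density P P' Q Q' f -> continuous_version P P' Q Q' f ->
  ~ (parallel P P' Q Q' /\
     l = set_dist (line_through P P') (line_through Q Q')) ->
  rho P P' Q Q' l = f l.
Proof.
move=> l0 df cf nl; rewrite /rho; case: xgetP => [g _ [dg cg]|/(_ f)]; last first.
  by move=> nf; exfalso; apply: nf.
have {}cf := cf l l0 nl; have {}cg := cg l l0 nl.
by apply/eqP; rewrite eq_le; apply/andP; split;
  [exact: (chord_length_density_le l0 dg df)|exact: (chord_length_density_le l0 df dg)].
Qed.

End uniqueness.

(** * Measurability of elementary functions *)

Section elementary.
Context {R : realType}.
Notation mR := (measurableTypeR R).

(** Inversion is continuous on the complement of the measurable set [{0}]. *)
Lemma measurable_fun_inv d (T : measurableType d) (D : set T) (f : T -> R) :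
  measurable_fun D (f : T -> mR) ->
  measurable_fun D ((fun x => (f x)^-1) : T -> mR).
Proof.
move=> mf; apply: (@measurableT_comp _ _ _ _ _ _ (fun x : mR => x^-1 : mR)) => //.
rewrite -(setvU [set 0%R : mR]).
have m0 : measurable ([set 0%R] : set mR) by exact: measurable_set1.
apply/measurable_funU => //; first exact: measurableC.
split.
  apply: open_continuous_measurable_fun.
    by apply: closed_openC; exact: closed_eq.
  by move=> x; rewrite inE => /eqP x0; exact: inv_continuous.
exact: measurable_fun_set1.
Qed.

Lemma measurable_fun_sin d (T : measurableType d) (D : set T) (f : T -> R) :
  measurable_fun D (f : T -> mR) ->
  measurable_fun D ((fun x => sin (f x)) : T -> mR).
Proof.
move=> mf; apply: (@measurableT_comp _ _ _ _ _ _ (sin : mR -> mR)) => //.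
by apply: continuous_measurable_fun; exact: continuous_sin.
Qed.

Lemma measurable_fun_cos d (T : measurableType d) (D : set T) (f : T -> R) :
  measurable_fun D (f : T -> mR) ->
  measurable_fun D ((fun x => cos (f x)) : T -> mR).
Proof.
move=> mf; apply: (@measurableT_comp _ _ _ _ _ _ (cos : mR -> mR)) => //.
by apply: continuous_measurable_fun; exact: continuous_cos.
Qed.

Lemma measurable_fun_itvcc d (T : measurableType d) (f : T -> R) (a b : R) :
  measurable_fun setT (f : T -> mR) -> measurable [set x | a <= f x <= b].
Proof.
move=> mf.
have -> : [set x | a <= f x <= b] = f @^-1` `[a, b]%classic.
  by apply/seteqP; split => x /=; rewrite in_itv.
by rewrite -[X in measurable X]setTI; apply: mf => //; exact: measurable_itv.
Qed.
End elementary.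

(** * Vectors and segments of the plane *)

Section plane.
Context {R : realType}.
Implicit Types (O u v X Y : R * R) (a b x y : R).

Lemma scale_fst x u : (x *: u).1 = x * u.1. Proof. by []. Qed.
Lemma scale_snd x u : (x *: u).2 = x * u.2. Proof. by []. Qed.
Lemma add_fst u v : (u + v).1 = u.1 + v.1. Proof. by []. Qed.
Lemma add_snd u v : (u + v).2 = u.2 + v.2. Proof. by []. Qed.
Lemma opp_fst u : (- u).1 = - u.1. Proof. by []. Qed.
Lemma opp_snd u : (- u).2 = - u.2. Proof. by []. Qed.
Definition vecE := (scale_fst, scale_snd, add_fst, add_snd, opp_fst, opp_snd).

Lemma vec_eq u v : u.1 = v.1 -> u.2 = v.2 -> u = v.
Proof. by case: u v => [a b] [c d] /= -> ->. Qed.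

Lemma crossDZr e O u x : cross e (O + x *: u) = cross e O + x * cross e u.
Proof. by rewrite /cross !vecE; ring. Qed.

Lemma segmentC O X : segment O X = segment X O.
Proof.
apply/seteqP; split => Y [t [t01 ->]]; exists (1 - t); (split; first by lra);
  by apply: vec_eq; rewrite !vecE; ring.
Qed.

Lemma segment_collinear O u a b X : a <= b ->
  segment (O + a *: u) (O + b *: u) X <->
  exists2 x, a <= x <= b & X = O + x *: u.
Proof.
move=> ab; split => [[t [t01 ->]]|[x xab ->]].
  exists (a + t * (b - a)).
    have : 0 <= t * (b - a) <= b - a.
      by rewrite mulr_ge0 ?ler_piMl ?subr_ge0//; case/andP: t01.
    by lra.
  by apply: vec_eq; rewrite !vecE; ring.
have [ab'|ab'] := eqVneq a b.
  exists 0; split; first by rewrite lexx ler01.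
  have -> : x = a by move: xab; rewrite -ab'; lra.
  by rewrite scale0r addr0.
have ba : 0 < b - a by rewrite subr_gt0 lt_neqAle ab' ab.
exists ((x - a) / (b - a)); split.
  by rewrite ler_pdivlMr// ler_pdivrMr//; lra.
apply: vec_eq; rewrite !vecE; field; lra.
Qed.

Definition dir a : R * R := (cos a, sin a).

Lemma straight_lineE p a X : straight_line (p, a) X <-> cross (dir a) X = p.
Proof. by rewrite /straight_line/= /cross/=. Qed.

Lemma cross_dir a b : cross (dir a) (dir b) = sin (b - a).
Proof. by rewrite /cross/= sinB; ring. Qed.

Lemma eucl_distE X Y :
  eucl_dist X Y = Num.sqrt ((Y.1 - X.1) ^+ 2 + (Y.2 - X.2) ^+ 2).
Proof. by rewrite /eucl_dist /eucl_norm /dot !vecE !expr2. Qed.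

End plane.

(** * Chords of a wedge *)

Section wedge.
Context {R : realType}.
Notation mR := (measurableTypeR R).
Notation mu := (@lebesgue_measure R).
Variables (O : R * R) (om ga k x0 x1 y1 y2 : R).
Hypotheses (k1 : `|k| = 1) (ga0 : 0 < ga < pi).
Hypotheses (x0_gt0 : 0 < x0) (x01 : x0 <= x1) (y1_gt0 : 0 < y1) (y12 : y1 <= y2).

Let u1 := dir (om + k * ga).
Let u2 := dir om.

Lemma sin_unit_mul (t : R) : sin (k * t) = k * sin t.
Proof.
have [kp|kn] := ltP 0 k; first by rewrite -(gtr0_norm kp) k1 !mul1r.
by rewrite -[k]opprK -(ler0_norm kn) k1 !mulN1r sinN.
Qed.

Lemma cos_unit_mul (t : R) : cos (k * t) = cos t.
Proof.
have [kp|kn] := ltP 0 k; first by rewrite -(gtr0_norm kp) k1 !mul1r.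
by rewrite -[k]opprK -(ler0_norm kn) k1 !mulN1r cosN.
Qed.

Let kk : k * k = 1. Proof. by rewrite -expr2 -real_normK ?num_real// k1 expr1n. Qed.
Let sga : 0 < sin ga. Proof. exact: sin_gt0_pi. Qed.

(** The number [q] is the signed distance from the vertex to the line, which meets
    the two sides at the distances [q / sin (b - ga)] and [q / sin b] of the
    vertex.  When a sine vanishes, the quotient is [0] by convention, and it is
    below the positive bounds [x0] and [y1]. *)
Definition wedge_set (E : set R) : set (mR * mR) :=
  [set z | [/\ x0 <= z.1 / sin (z.2 - ga) <= x1, y1 <= z.1 / sin z.2 <= y2 &
     E `|z.1 * sin ga / (sin (z.2 - ga) * sin z.2)| ] ].

Lemma wedge_dist x y : eucl_dist (O + x *: u1) (O + y *: u2) =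
  Num.sqrt (x ^+ 2 + y ^+ 2 - x * y * cos ga *+ 2).
Proof.
rewrite eucl_distE !vecE /u1 /u2 /dir/= cosD sinD sin_unit_mul cos_unit_mul.
congr Num.sqrt.
have c1 := cos2Dsin2 om; have c2 := cos2Dsin2 ga.
transitivity (y ^+ 2 * (cos om ^+ 2 + sin om ^+ 2) +
  x ^+ 2 * (cos om ^+ 2 + sin om ^+ 2) * (cos ga ^+ 2 + k * k * sin ga ^+ 2)
  - x * y * cos ga * (cos om ^+ 2 + sin om ^+ 2) *+ 2); first by ring.
by rewrite kk c1 mul1r c2; ring.
Qed.

(** Law of cosines in a triangle inscribed in a circle of diameter 1: its sides
    are the sines of its angles [ga], [b - ga] and [pi - b]. *)
Lemma sin_triangle b : sin (b - ga) ^+ 2 + sin b ^+ 2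
  - sin b * sin (b - ga) * cos ga *+ 2 = sin ga ^+ 2.
Proof.
rewrite sinB.
have c1 := cos2Dsin2 b; have c2 := cos2Dsin2 ga.
transitivity (sin ga ^+ 2 * (cos b ^+ 2 + sin b ^+ 2) +
  sin b ^+ 2 * (1 - (cos ga ^+ 2 + sin ga ^+ 2))); first by ring.
by rewrite c1 c2; ring.
Qed.

Lemma wedge_chords E q b :
  chords (O + x1 *: u1) (O + x0 *: u1) (O + y1 *: u2) (O + y2 *: u2) E
    (straight_line (cross (dir (om + k * b)) O + (- k) * q, om + k * b)) <->
  wedge_set E (q, b).
Proof.
have cM x : straight_line (cross (dir (om + k * b)) O + (- k) * q, om + k * b)
    (O + x *: u1) <-> x * sin (b - ga) = q.
  rewrite straight_lineE crossDZr cross_dir.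
  have -> : om + k * ga - (om + k * b) = k * - (b - ga) by ring.
  rewrite sin_unit_mul sinN; split => [|<-]; last by ring.
  move/addrI => xk.
  transitivity (- k * (- k * q)); last by rewrite mulrA mulrNN kk mul1r.
  rewrite -xk; transitivity (k * k * (x * sin (b - ga))); last by ring.
  by rewrite kk mul1r.
have cN y : straight_line (cross (dir (om + k * b)) O + (- k) * q, om + k * b)
    (O + y *: u2) <-> y * sin b = q.
  rewrite straight_lineE crossDZr cross_dir.
  have -> : om - (om + k * b) = k * - b by ring.
  rewrite sin_unit_mul sinN; split => [|<-]; last by ring.
  move/addrI => xk.
  transitivity (- k * (- k * q)); last by rewrite mulrA mulrNN kk mul1r.
  rewrite -xk; transitivity (k * k * (y * sin b)); last by ring.
  by rewrite kk mul1r.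
have dE x y : x * sin (b - ga) = q -> y * sin b = q ->
    sin (b - ga) != 0 -> sin b != 0 ->
    eucl_dist (O + x *: u1) (O + y *: u2) =
    `|q * sin ga / (sin (b - ga) * sin b)|.
  move=> xq yq s1 s2.
  have -> : x = q / sin (b - ga) by rewrite -xq mulfK.
  have -> : y = q / sin b by rewrite -yq mulfK.
  rewrite wedge_dist -sqrtr_sqr; congr Num.sqrt.
  rewrite [RHS]expr_div_n [in RHS]exprMn -(sin_triangle b).
  by field; rewrite s1 s2.
rewrite /chords /wedge_set [segment (O + x1 *: _) _]segmentC/=; split.
- case=> M [N [/(segment_collinear _ _ _ x01)[x x01' ->]]].
  case/(segment_collinear _ _ _ y12) => y y12' -> /cM xq /cN yq.
  (* A line parallel to the first side meets it only if it carries it; then it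
     goes through the vertex and cannot reach the second segment. *)
  have s1 : sin (b - ga) != 0.
    apply/eqP => s1; move: xq; rewrite s1 mulr0 => q0.
    move: yq; rewrite -q0 => /eqP; rewrite mulf_eq0 => 
      /orP[/eqP y_0|/eqP sb]; first by move: y12'; rewrite y_0 leNgt y1_gt0.
    move: sga; have -> : ga = b - (b - ga) by ring.
    by rewrite sinB s1 sb mul0r mulr0 subrr ltxx.
  have s2 : sin b != 0.
    apply/eqP => s2; move: yq; rewrite s2 mulr0 => q0.
    move: xq; rewrite -q0 => /eqP; rewrite mulf_eq0 (negbTE s1) orbF => /eqP x_0.
    by move: x01'; rewrite x_0 leNgt x0_gt0.
  rewrite (dE x y)// => El; split => //.
    by rewrite -xq mulfK.
  by rewrite -yq mulfK.
- case=> xx yy El.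
  have s1 : sin (b - ga) != 0.
    by apply/eqP => s1; move: xx; rewrite s1 invr0 mulr0 leNgt x0_gt0.
  have s2 : sin b != 0.
    by apply/eqP => s2; move: yy; rewrite s2 invr0 mulr0 leNgt y1_gt0.
  exists (O + (q / sin (b - ga)) *: u1), (O + (q / sin b) *: u2); split.
  + by apply/segment_collinear => //; exists (q / sin (b - ga)).
  + by apply/segment_collinear => //; exists (q / sin b).
  + by apply/cM; rewrite divfK.
  + by apply/cN; rewrite divfK.
  + by rewrite dE// divfK.
Qed.

Lemma measurable_wedge_set (E : set mR) : measurable E -> measurable (wedge_set E).
Proof.
move=> mE.
have mq : measurable_fun setT (fun z : mR * mR => z.1 : mR).
  exact: measurable_fst.
have mb : measurable_fun setT (fun z : mR * mR => z.2 : mR).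
  exact: measurable_snd.
have ms : measurable_fun setT (fun z : mR * mR => sin z.2 : mR).
  exact: measurable_fun_sin.
have msg : measurable_fun setT (fun z : mR * mR => sin (z.2 - ga) : mR).
  by apply: measurable_fun_sin; exact: measurable_funB.
have -> : wedge_set E = [set z | x0 <= z.1 / sin (z.2 - ga) <= x1] `&`
    [set z | y1 <= z.1 / sin z.2 <= y2] `&`
    (fun z => `|z.1 * sin ga / (sin (z.2 - ga) * sin z.2)| : mR) @^-1` E.
  apply/seteqP; split => z /=; first by move=> [a b c]; split; [split|].
  by move=> [[a b] c]; split.
apply: measurableI; first apply: measurableI.
- apply: measurable_fun_itvcc; apply: measurable_funM => //.
  exact: measurable_fun_inv.
- apply: measurable_fun_itvcc; apply: measurable_funM => //.
  exact: measurable_fun_inv.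
- rewrite -[X in measurable X]setTI.
  suff : measurable_fun setT (fun z : mR * mR =>
      `|z.1 * sin ga / (sin (z.2 - ga) * sin z.2)| : mR) by exact.
  apply: (@measurableT_comp _ _ _ _ _ _ (fun x : mR => `|x| : mR)) => //.
  exact: normr_measurable.
  apply: measurable_funM; first by apply: measurable_funM.
  by apply: measurable_fun_inv; apply: measurable_funM.
Qed.

(** Pairs (length, direction): by the law of sines, these are the distances from
    the vertex to the ends of the chord. *)
Definition wedge_dom : set (mR * mR) :=
  [set z | x0 <= z.1 * sin z.2 / sin ga <= x1 /\
           y1 <= z.1 * sin (z.2 - ga) / sin ga <= y2].

(** The ratio between [q] and the length of the chord. *)
Definition wedge_weight (b : R) : R := sin b * sin (b - ga) / sin ga.

Lemma wedge_dom_gt0 l b : 0 < l -> wedge_dom (l, b) ->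
  0 < sin b /\ 0 < sin (b - ga).
Proof.
move=> l0 [/= /andP[xx _] /andP[yy _]].
have {}xx := lt_le_trans x0_gt0 xx; have {}yy := lt_le_trans y1_gt0 yy.
have sv : 0 < (sin ga)^-1 by rewrite invr_gt0.
by move: xx yy; rewrite !(pmulr_lgt0 _ sv) !(pmulr_rgt0 _ l0).
Qed.

Lemma measurable_wedge_dom : measurable wedge_dom.
Proof.
have -> : wedge_dom = [set z | x0 <= z.1 * sin z.2 / sin ga <= x1] `&`
           [set z | y1 <= z.1 * sin (z.2 - ga) / sin ga <= y2].
  by apply/seteqP; split => z.
have mq : measurable_fun setT (fun z : mR * mR => z.1 : mR).
  exact: measurable_fst.
have mb : measurable_fun setT (fun z : mR * mR => z.2 : mR).
  exact: measurable_snd.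
apply: measurableI; apply: measurable_fun_itvcc; do 2 apply: measurable_funM => //.
  exact: measurable_fun_sin.
by apply: measurable_fun_sin; exact: measurable_funB.
Qed.

(** In a given direction the chords are sides of homothetic triangles, so their
    length is proportional to [q]; an affine change of variable replaces [q] by
    the length. *)
Lemma wedge_section (E : set mR) b : measurable E -> E `<=` `]0, +oo[ ->
  0 <= b < pi ->
  (mu (ysection (wedge_set E) b) =
   \int[mu]_(l in E) (\1_wedge_dom (l, b) * wedge_weight b)%:E)%E.
Proof.
move=> mE E0 b0pi.
have El l : E l -> 0 < l by move/E0; rewrite /= in_itv/= andbT.
have sb : 0 <= sin b by apply: sin_ge0_pi; lra.
have [[s0 s1]|ns] := pselect (0 < sin b /\ 0 < sin (b - ga)); last first.
  have -> : ysection (wedge_set E) b = set0.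
    apply/seteqP; split => q //=; rewrite /ysection/= inE => -[/= xx yy _].
    apply: ns; have sb0 : 0 < sin b.
      rewrite lt_neqAle sb andbT eq_sym; apply/eqP => s2.
      by move: yy; rewrite s2 invr0 mulr0 leNgt y1_gt0.
    split=> //; have q0 : 0 < q.
      case/andP: yy => /(lt_le_trans y1_gt0); by rewrite pmulr_lgt0 ?invr_gt0.
    case/andP: xx => /(lt_le_trans x0_gt0); by rewrite pmulr_rgt0// invr_gt0.
  rewrite measure0 integral0_eq// => l /El l0.
  rewrite indicE; case: (boolP (_ \in _)); last by rewrite mul0r.
  by rewrite inE => /(wedge_dom_gt0 l0).
have w0 : 0 < wedge_weight b by rewrite /wedge_weight divr_gt0// mulr_gt0.
rewrite (@lebesgue_measure_affine R (wedge_weight b) 0)//; last 2 first.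
- by rewrite gt_eqF.
- by apply: measurable_ysection; exact: measurable_wedge_set.
rewrite gtr0_norm//.
under eq_integral do rewrite EFinM muleC.
have mD : measurable (ysection wedge_dom b).
  by apply: measurable_ysection; exact: measurable_wedge_dom.
have E1 l : \1_wedge_dom (l, b) = \1_(ysection wedge_dom b) l :> R.
  by rewrite !indicE mem_ysection.
rewrite ge0_integralZl//; last 2 first.
- have -> : (fun l : mR => (\1_wedge_dom (l, b))%:E) =
      EFin \o (\1_(ysection wedge_dom b) : mR -> R).
    by apply/funext => l /=; rewrite E1.
  by apply/measurable_EFinP/measurable_funTS; exact: measurable_indic.
- by rewrite lee_fin ltW.
congr (_ * _)%E.
under eq_integral do rewrite E1.
rewrite integral_indic//; congr (mu _).
have qx l : (wedge_weight b * l + 0) / sin (b - ga) = l * sin b / sin ga.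
  by rewrite /wedge_weight; field; rewrite !gt_eqF.
have qy l : (wedge_weight b * l + 0) / sin b = l * sin (b - ga) / sin ga.
  by rewrite /wedge_weight; field; rewrite !gt_eqF.
have qE l : (wedge_weight b * l + 0) * sin ga / (sin (b - ga) * sin b) = l.
  by rewrite /wedge_weight; field; rewrite !gt_eqF.
apply/seteqP; split => l /=; rewrite /ysection/= !inE/= /wedge_set/= qx qy qE.
  move=> [xx yy El']; have l0 : 0 < l.
    case/andP: xx => /(lt_le_trans x0_gt0); rewrite pmulr_lgt0 ?invr_gt0//.
    by rewrite (pmulr_lgt0 _ s0).
  by split; [split|rewrite -(gtr0_norm l0)].
by move=> [[/= xx yy] El']; split => //; rewrite gtr0_norm// El.
Qed.

End wedge.

(** * Density of the chord lengths of a wedge *)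

Section local_constancy.
Context {R : realType}.

Lemma near_itv_cst (v : R -> R) (a c l : R) : {for l, continuous v} ->
  v l != a -> v l != c -> \forall x \near l, (a <= v x <= c) = (a <= v l <= c).
Proof.
move=> cv va vc.
have near_le (e : R) : v l != e ->
    \forall x \near l, (v x < e) = (v l < e) /\ (e < v x) = (e < v l).
  move=> ve; have [lt_ve|lt_ev|/eqP] := ltgtP (v l) e; last by rewrite (negbTE ve).
    have : \forall x \near l, v x < e by exact: (cvgr_lt (v l) cv).
    by apply: filterS => x xe; rewrite xe; split => //; apply/negbTE; rewrite -leNgt ltW.
  have : \forall x \near l, e < v x by exact: (cvgr_gt (v l) cv).
  by apply: filterS => x xe; rewrite xe; split => //; apply/negbTE; rewrite -leNgt ltW.
have na := near_le _ va; have nc := near_le _ vc.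
by apply: filterS2 na nc => x [a1 a2] [c1 c2]; rewrite !leNgt a1 c2.
Qed.

Lemma sin_eq_pos (b c : R) : - pi <= b <= pi -> 0 < c -> sin b = c ->
  b = asin c \/ b = pi - asin c.
Proof.
move=> bpi c0 sbc.
have b0 : 0 < b.
  rewrite ltNge; apply/negP => b0.
  have : 0 <= sin (- b) by apply: sin_ge0_pi; lra.
  by rewrite sinN sbc; lra.
have [bp|bp] := leP b (pi / 2).
  by left; rewrite -sbc sinK// in_itv/=; lra.
right; have sb : sin (pi - b) = c.
  by rewrite sinB sinpi cospi mul0r mulN1r sub0r opprK.
by rewrite -sb sinK ?in_itv/=; lra.
Qed.

Lemma negligible_seq (s : seq R) : (@lebesgue_measure R).-negligible [set` s].
Proof.
have cs : countable [set` s] by exact/finite_set_countable/finite_seq.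
exists [set` s]; split => //; last exact: countable_lebesgue_measure0.
by apply: countable_measurable => // t; exact: measurable_set1.
Qed.

End local_constancy.

Section tonelli_sets.
Context d1 d2 (T1 : measurableType d1) (T2 : measurableType d2) {R : realType}.
Variables (m1 : {sigma_finite_measure set T1 -> \bar R}).
Variables (m2 : {sigma_finite_measure set T2 -> \bar R}).

Lemma tonelli_sets (A : set T1) (B : set T2) (F : T1 * T2 -> \bar R) :
  measurable A -> measurable B -> measurable_fun setT F ->
  (forall x y, A x -> B y -> 0 <= F (x, y))%E ->
  (\int[m1]_(x in A) \int[m2]_(y in B) F (x, y) =
   \int[m2]_(y in B) \int[m1]_(x in A) F (x, y))%E.
Proof.
move=> mA mB mF F0.
have mAB : measurable (A `*` B) by exact: measurableX.
have := @fubini_tonelli _ _ _ _ _ m1 m2 (F \_ (A `*` B)).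
have -> : (fun x => \int[m2]_y (F \_ (A `*` B)) (x, y))%E =
    (fun x => \int[m2]_(y in B) F (x, y))%E \_ A.
  apply/funext => x; rewrite patchE; case: ifPn => [xA|xA].
    rewrite [RHS]integral_mkcond; apply: eq_integral => y _.
    by rewrite !patchE in_setX xA.
  by apply: integral0_eq => y _; rewrite patchE in_setX (negbTE xA).
have -> : (fun y => \int[m1]_x (F \_ (A `*` B)) (x, y))%E =
    (fun y => \int[m1]_(x in A) F (x, y))%E \_ B.
  apply/funext => y; rewrite patchE; case: ifPn => [yB|yB].
    rewrite [RHS]integral_mkcond; apply: eq_integral => x _.
    by rewrite !patchE in_setX yB andbT.
  by apply: integral0_eq => x _; rewrite patchE in_setX (negbTE yB) andbF.
rewrite -!integral_mkcond; apply.
  by apply/(measurable_restrictT _ _).1 => //; exact: measurable_funS mF.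
by apply: erestrict_ge0 => -[x y] [/= Ax By]; exact: F0.
Qed.

End tonelli_sets.

Section wedge_density.
Context {R : realType}.
Notation mR := (measurableTypeR R).
Notation mu := (@lebesgue_measure R).
Variables (O : R * R) (om ga k x0 x1 y1 y2 : R).
Hypotheses (k1 : `|k| = 1) (ga0 : 0 < ga < pi).
Hypotheses (x0_gt0 : 0 < x0) (x01 : x0 <= x1) (y1_gt0 : 0 < y1) (y12 : y1 <= y2).

Let u1 := dir (om + k * ga).
Let u2 := dir om.
Let sga : 0 < sin ga. Proof. exact: sin_gt0_pi. Qed.
Let D := wedge_dom ga x0 x1 y1 y2.
Let w := @wedge_weight R ga.

Let mD : measurable D. Proof. exact: measurable_wedge_dom. Qed.

Lemma continuous_wedge_weight : continuous w.
Proof.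
move=> b; apply: cvgM; last exact: cvg_cst.
apply: cvgM; first exact: continuous_sin.
apply: continuous_comp; last exact: continuous_sin.
by apply: cvgB; [exact: cvg_id|exact: cvg_cst].
Qed.

Lemma measurable_wedge_weight : measurable_fun setT (w : mR -> mR).
Proof. by apply: continuous_measurable_fun; exact: continuous_wedge_weight. Qed.

Definition wedge_integrand (l b : R) : R := \1_D (l, b) * w b.

Definition wedge_density (l : R) : R :=
  \int[mu]_(b in `[0, pi]) wedge_integrand l b.

Lemma wedge_integrand_ge0 l b : 0 < l -> 0 <= wedge_integrand l b.
Proof.
move=> l0; rewrite /wedge_integrand indicE.
case: (boolP (_ \in _)); rewrite ?mul0r// inE => Dlb.
have [s0 s1] := wedge_dom_gt0 ga0 x0_gt0 y1_gt0 l0 Dlb.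
by rewrite mul1r /w /wedge_weight divr_ge0// ?mulr_ge0// ltW.
Qed.

Lemma wedge_integrand_le l b : `|wedge_integrand l b| <= (sin ga)^-1.
Proof.
rewrite /wedge_integrand normrM /w /wedge_weight !normrM normfV (gtr0_norm sga).
rewrite mulrA -[leRHS]mul1r; apply: ler_wpM2r; first by rewrite invr_ge0 ltW.
rewrite !mulr_ile1// ?mulr_ge0// ?mulr_ile1// ?sin_max//.
by rewrite indicE; case: (_ \in _); rewrite ?normr0 ?normr1.
Qed.

Lemma measurable_wedge_integrand l (A : set mR) :
  measurable_fun A (wedge_integrand l : mR -> mR).
Proof.
apply: measurable_funTS; apply: measurable_funM; last exact: measurable_wedge_weight.
rewrite (_ : (fun _ => _) = \1_(xsection D l)); last first.
  by apply/funext => b; rewrite !indicE mem_xsection.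
by apply: measurable_indic; exact: measurable_xsection.
Qed.

Lemma integrable_wedge_integrand l :
  mu.-integrable `[0, pi] (EFin \o wedge_integrand l).
Proof.
apply: measurable_bounded_integrable => //.
- by rewrite /= lebesgue_measure_itv/= lte_fin pi_gt0 -EFinB ltry.
- exact: measurable_wedge_integrand.
- exists (sin ga)^-1; split; first by rewrite num_real.
  by move=> M /ltW sM b _ /=; exact: le_trans (wedge_integrand_le _ _) sM.
Qed.

Lemma EFin_wedge_density l :
  (wedge_density l)%:E = (\int[mu]_(b in `[0%R, pi]) (wedge_integrand l b)%:E)%E.
Proof.
rewrite /wedge_density /Rintegral fineK//.
by apply: integrable_fin_num; [exact: measurable_itv|exact: integrable_wedge_integrand].
Qed.

(** For a fixed direction the integrand is locally constant in the length, unless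
    an end of the chord is an end of a segment; this occurs for finitely many
    directions only.  As the integrand is bounded, dominated convergence applies. *)
Lemma continuous_wedge_density l : 0 < l -> {for l, continuous wedge_density}.
Proof.
move=> l0; apply/(@cvg_nbhsP R R^o) => u ul; have pi0 := pi_gt0 R.
pose c1 := x0 * sin ga / l; pose c2 := x1 * sin ga / l.
pose e1 := y1 * sin ga / l; pose e2 := y2 * sin ga / l.
(* Among these are the directions of the chords of length l that end at an end
   of one of the segments. *)
pose B := [set` [:: asin c1; pi - asin c1; asin c2; pi - asin c2;
   asin e1 + ga; pi - asin e1 + ga; asin e2 + ga; pi - asin e2 + ga]].
have c_pos (z : R) : 0 < z -> 0 < z * sin ga / l by move=> z0; rewrite divr_gt0// mulr_gt0.
have x1_gt0 : 0 < x1 by exact: lt_le_trans x01.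
have y2_gt0 : 0 < y2 by exact: lt_le_trans y12.
have cst_ind (b : R) : 0 <= b <= pi -> ~ B b ->
    \forall l' \near l, \1_D (l', b) = \1_D (l, b) :> R.
  move=> b0pi nB.
  have cX (t : R) : {for l, continuous (fun x : R => x * t / sin ga)}.
    apply: cvgM; last exact: cvg_cst.
    by apply: cvgM; [exact: cvg_id|exact: cvg_cst].
  have neq (z s : R) : 0 < z -> - pi <= s <= pi -> s != asin (z * sin ga / l) ->
      s != pi - asin (z * sin ga / l) -> l * sin s / sin ga != z.
    move=> z0 spi h1 h2; apply/eqP => zE.
    have ss : sin s = z * sin ga / l by rewrite -zE; field; rewrite !gt_eqF.
    by have [e|e] := sin_eq_pos spi (c_pos _ z0) ss; move: h1 h2; rewrite -e eqxx.
  have nBb (s : R) : s \in [:: asin c1; pi - asin c1; asin c2; pi - asin c2;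
   asin e1 + ga; pi - asin e1 + ga; asin e2 + ga; pi - asin e2 + ga] -> b != s.
    by move=> sB; apply/eqP => bs; apply: nB; rewrite /B/= bs.
  have nx (z : R) : z = x0 \/ z = x1 -> l * sin b / sin ga != z.
    move=> zz; have z0 : 0 < z by case: zz => ->.
    have bb : - pi <= b <= pi by lra.
    by apply: neq => //; apply: nBb; case: zz => ->; rewrite !inE eqxx ?orbT.
  have ny (z : R) : z = y1 \/ z = y2 -> l * sin (b - ga) / sin ga != z.
    move=> zz; have z0 : 0 < z by case: zz => ->.
    have bb : - pi <= b - ga <= pi by move: (ga0); lra.
    by apply: neq => //; rewrite subr_eq; apply: nBb; case: zz => ->;
       rewrite !inE eqxx ?orbT.
  have nX := near_itv_cst (cX (sin b)) (nx _ (or_introl erefl)) (nx _ (or_intror erefl)).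
  have nY := near_itv_cst (cX (sin (b - ga)))
    (ny _ (or_introl erefl)) (ny _ (or_intror erefl)).
  apply: filterS2 nX nY => l' X Y; rewrite !indicE; congr (nat_of_bool _)%:R.
  by apply/idP/idP; rewrite !inE => -[/= a1 a2]; split=> /=;
    rewrite ?X ?Y// -?X -?Y.
have Bnull : mu.-negligible B by exact: negligible_seq.
have [|||||_ _ H] := @dominated_convergence _ _ _ mu `[0, pi]%classic (measurable_itv _)
  (fun n => EFin \o wedge_integrand (u n)) (EFin \o wedge_integrand l)
  (EFin \o cst (sin ga)^-1).
- by move=> n; apply/measurable_EFinP; exact: measurable_wedge_integrand.
- by apply/measurable_EFinP; exact: measurable_wedge_integrand.
- apply: negligibleS Bnull => b /= nb; apply: contrapT => nB; apply: nb => b0pi.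
  rewrite in_itv/= in b0pi.
  have nD : \forall n \near \oo, \1_D (u n, b) = \1_D (l, b) :> R.
    exact: ul _ (cst_ind b b0pi nB).
  apply: cvg_near_cst; apply: filterS nD => n /= nE.
  by rewrite /wedge_integrand nE.
- apply: integrable_cst_finite => //.
  by rewrite /= lebesgue_measure_itv/= lte_fin pi_gt0 -EFinB ltry.
- by apply: aeW => b n _ /=; rewrite lee_fin wedge_integrand_le.
by apply: fine_cvg; rewrite EFin_wedge_density.
Qed.

Lemma line_measure_wedge (E : set mR) : measurable E -> E `<=` `]0, +oo[ ->
  line_measure (chords (O + x1 *: u1) (O + x0 *: u1) (O + y1 *: u2) (O + y2 *: u2) E) =
  (\int[mu]_(l in E) (wedge_density l)%:E)%E.
Proof.
move=> mE E0.
have El l : E l -> 0 < l by move/E0; rewrite /= in_itv/= andbT.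
rewrite (@line_measure_polar R _ om k (- k)
  (fun b => cross (dir (om + k * b)) O) (wedge_set ga x0 x1 y1 y2 E))//; last 4 first.
- by rewrite normrN.
- have mb : measurable_fun setT ((fun b => om + k * b) : mR -> mR).
    by apply: measurable_funD => //; apply: measurable_funM.
  by apply: measurable_funB; apply: measurable_funM => //;
    [exact: measurable_fun_cos|exact: measurable_fun_sin].
- exact: measurable_wedge_set.
- by move=> q b; exact: wedge_chords.
transitivity (\int[mu]_(b in `[0%R, pi[)
    \int[mu]_(l in E) (wedge_integrand l b)%:E)%E.
  apply: eq_integral => b; rewrite inE/= in_itv/= => b0pi.
  exact: wedge_section.
under [RHS]eq_integral => l _.
  rewrite EFin_wedge_density -integral_itv_bndo_bndc; last first.
    by apply/measurable_EFinP; exact: measurable_wedge_integrand.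
  over.
rewrite (@tonelli_sets _ _ _ _ _ mu mu `[0, pi[%classic E
  (fun z => (wedge_integrand z.2 z.1)%:E))//.
  apply/measurable_EFinP; apply: measurable_funM; last first.
    exact: (measurableT_comp measurable_wedge_weight measurable_fst).
  have mswap : measurable_fun setT (fun z : mR * mR => (z.2, z.1)).
    by apply: measurable_fun_pair; [exact: measurable_snd|exact: measurable_fst].
  apply: (@measurableT_comp _ _ _ _ _ _ (\1_D : _ -> mR)) mswap.
  exact: measurable_indic.
by move=> b l _ /El l0; rewrite lee_fin wedge_integrand_ge0.
Qed.

Lemma chord_length_density_wedge :
  chord_length_density (O + x1 *: u1) (O + x0 *: u1)
    (O + y1 *: u2) (O + y2 *: u2) wedge_density.
Proof.
split; last by move=> E mE E0; rewrite line_measure_wedge.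
apply: open_continuous_measurable_fun; first exact: interval_open.
by move=> l; rewrite inE/= in_itv/= andbT; exact: continuous_wedge_density.
Qed.

Lemma rho_wedge l : 0 < l -> x0 < x1 -> y1 < y2 ->
  rho (O + x1 *: u1) (O + x0 *: u1) (O + y1 *: u2) (O + y2 *: u2) l =
  wedge_density l.
Proof.
move=> l0 lt_x lt_y; apply: rho_eq => //.
- exact: chord_length_density_wedge.
- by move=> z z0 _; exact: continuous_wedge_density.
- case=> /eqP + _.
  have -> : (O + x0 *: u1) - (O + x1 *: u1) = (x0 - x1) *: u1.
    by apply: vec_eq; rewrite !vecE; ring.
  have -> : (O + y2 *: u2) - (O + y1 *: u2) = (y2 - y1) *: u2.
    by apply: vec_eq; rewrite !vecE; ring.
  have -> : cross ((x0 - x1) *: u1) ((y2 - y1) *: u2) = (x0 - x1) * (y2 - y1) * cross u1 u2.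
    by rewrite /cross !vecE; ring.
  rewrite cross_dir (_ : om - _ = k * - ga); last by ring.
  rewrite sin_unit_mul// sinN !mulf_eq0 oppr_eq0 !subr_eq0.
  rewrite (lt_eqF lt_x) (gt_eqF lt_y) (gt_eqF sga) orbF/=.
  by rewrite -normr_eq0 k1 oner_eq0.
Qed.

End wedge_density.

(** * Short segments in a wedge *)

Section calculus.
Context {R : realType}.
Notation mu := (@lebesgue_measure R).

Lemma integral_derive (F f : R -> R) (a b : R) : a <= b ->
  (forall x, a <= x <= b -> {for x, continuous f}) ->
  (forall x : R, a <= x <= b -> is_derive x 1 F (f x)) ->
  (\int[mu]_(x in `[a, b]) (f x)%:E = (F b - F a)%:E)%E.
Proof.
move=> ab cf dF; have [ab'|ab'] := eqVneq a b.
  by rewrite ab' set_itv1 integral_set1 subrr.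
have cF (x : R) : a <= x <= b -> {for x, continuous F}.
  move=> xab; apply: differentiable_continuous; apply/derivable1_diffP.
  exact: (@ex_derive _ _ _ _ _ _ _ (dF x xab)).
have oc (x : R) : x \in `]a, b[ -> a <= x <= b by rewrite in_itv/=; lra.
rewrite (@continuous_FTC2 _ f F) ?EFinB//.
- by rewrite lt_neqAle ab' ab.
- by apply: continuous_in_subspaceT => x; rewrite inE/= in_itv/=; exact: cf.
- split.
  + by move=> x /oc xab; exact: (@ex_derive _ _ _ _ _ _ _ (dF x xab)).
  + by apply: cvg_at_right_filter; apply: cF; rewrite lexx.
  + by apply: cvg_at_left_filter; apply: cF; rewrite lexx andbT.
- by move=> x /oc xab; rewrite derive1E; exact: (@derive_val _ _ _ _ _ _ _ (dF x xab)).
Qed.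

Lemma cvg_right_quotient (g : R -> R) (dg : R) : is_derive (0 : R) 1 g dg ->
  t^-1 * (g t - g 0) @[t --> 0^'+] --> dg.
Proof.
move=> [+ <-] => /cvg_ex[l gl].
have gl' : h^-1 *: (g (h *: 1 + 0) - g 0) @[h --> 0^'+] --> l.
  exact: cvg_dnbhs_at_right gl.
rewrite (_ : 'D_1 g 0 = l); last exact: cvg_lim gl.
apply: cvg_trans gl'; apply: near_eq_cvg; near=> h.
by rewrite /= addr0 [h *: 1]mulr1.
Unshelve. all: by end_near. Qed.

End calculus.

Section wedge_limit.
Context {R : realType}.
Notation mR := (measurableTypeR R).
Notation mu := (@lebesgue_measure R).
Variables (ga x y1 y2 l : R).
Hypotheses (ga0 : 0 < ga < pi) (x_gt0 : 0 < x) (y1_gt0 : 0 < y1) (y12 : y1 <= y2).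
Hypothesis (l0 : 0 < l).

Let sga : 0 < sin ga. Proof. exact: sin_gt0_pi. Qed.
Let w := @wedge_weight R ga.

(** A chord that starts at the distance [z] of the vertex is at least
    [z sin ga] long, the distance from its first end to the other side. *)
Lemma cvg_wedge_density_lt : l < x * sin ga ->
  t^-1 * wedge_density ga (x - t) x y1 y2 l @[t --> 0^'+] --> 0.
Proof.
move=> lx; apply: cvg_near_cst.
have e0 : 0 < x - l / sin ga by rewrite subr_gt0 ltr_pdivrMr.
near=> t.
have te : t < x - l / sin ga by near: t; exact: nbhs_right_lt.
rewrite /wedge_density /Rintegral integral0_eq ?mulr0// => b _.
rewrite /wedge_integrand indicE; case: (boolP (_ \in _)); last by rewrite mul0r.
rewrite inE => -[/= /andP[+ _] _]; rewrite leNgt.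
suff -> : l * sin b / sin ga < x - t by [].
rewrite (@le_lt_trans _ _ (l / sin ga))//; last by lra.
by rewrite ler_pM2r ?invr_gt0// ler_piMr ?sin_le1// ltW.
Unshelve. all: by end_near. Qed.

(** An antiderivative of the weight, according to
    [2 sin b sin (b - ga) = cos ga - cos (2 b - ga)]. *)
Definition wedge_prim (b : R) : R :=
  (2 * sin ga)^-1 * (b * cos ga - 2^-1 * sin (2 * b - ga)).

Lemma is_derive_wedge_prim (b : R) : is_derive b 1 wedge_prim (w b).
Proof.
have d1 : is_derive b 1 (fun b : R => 2 * b - ga) 2.
  by apply: is_derive_eq; rewrite subr0 /GRing.scale/= mulr1.
have d2 : is_derive b 1 (fun b : R => sin (2 * b - ga)) (cos (2 * b - ga) * 2).
  exact: is_derive1_comp.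
rewrite /wedge_prim; apply: is_derive_eq.
rewrite /GRing.scale/= mulr0 add0r mulr1 /w /wedge_weight.
have -> : 2 * b - ga = b + (b - ga) by ring.
have -> : cos ga = cos (b - (b - ga)) by congr cos; ring.
by rewrite (cosB b (b - ga)) (cosD b (b - ga)); field; rewrite gt_eqF.
Qed.

Hypothesis xl : x * sin ga < l.

(* The direction under which a chord of length l leaves the point at distance
   x - t from the vertex. *)
Let s (t : R) := asin ((x - t) * sin ga / l).
Let s0 := s 0.

Let c01 t : 0 <= t < x -> 0 < (x - t) * sin ga / l < 1.
Proof.
move=> tx; rewrite divr_gt0 ?mulr_gt0//=; last by lra.
rewrite ltr_pdivrMr// mul1r; apply: le_lt_trans xl.
by apply: ler_wpM2r; [exact: ltW|lra].
Qed.

Let sin_s t : 0 <= t < x -> sin (s t) = (x - t) * sin ga / l.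
Proof. by move=> /c01 c; rewrite /s asinK// in_itv/=; lra. Qed.

Let s_gt0 t : 0 <= t < x -> 0 < s t < pi / 2.
Proof.
move=> tx; have := c01 tx => c; rewrite asin_ltpi2 ?andbT; last by lra.
have sx := sin_s tx; rewrite ltNge; apply/negP => s_le0.
have : - (pi / 2) <= s t by apply: asin_geNpi2; lra.
have pi0 := pi_gt0 R; move=> sge.
have : 0 <= sin (- s t) by apply: sin_ge0_pi; lra.
by rewrite sinN sx; lra.
Qed.

Let s_lt t : 0 < t < x -> s t < s0.
Proof.
move=> tx; have tx' : 0 <= t < x by lra.
have h1 := s_gt0 tx'; have h2 : 0 < s0 < pi / 2 by apply: s_gt0; rewrite lexx.
have pi0 := pi_gt0 R.
rewrite -ltr_sin ?in_itv/=; try lra.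
rewrite (sin_s tx') /s0 sin_s ?lexx// subr0 ltr_pM2r ?invr_gt0// ltr_pM2r//; lra.
Qed.

Let Y (b : R) : bool := y1 <= l * sin (b - ga) / sin ga <= y2.

Let sin_pi (b : R) : sin (pi - b) = sin b.
Proof. by rewrite sinB sinpi cospi mul0r mulN1r sub0r opprK. Qed.

(** The directions of the chords of length [l] whose first end lies between the
    distances [x - t] and [x] form two thin intervals, exchanged by the symmetry
    [b -> pi - b] of the sine. *)
Let slice (b t : R) : 0 < t < x -> 0 <= b <= pi ->
  x - t <= l * sin b / sin ga <= x <->
  s t <= b <= s0 \/ pi - s0 <= b <= pi - s t.
Proof.
move=> tx bpi; have tx' : 0 <= t < x by lra.
have h1 := s_gt0 tx'; have h2 : 0 < s0 < pi / 2 by apply: s_gt0; rewrite lexx.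
have pi0 := pi_gt0 R.
have st := s_lt tx.
have sE : (x - t <= l * sin b / sin ga <= x) = (sin (s t) <= sin b <= sin s0).
  rewrite sin_s// /s0 sin_s ?lexx// subr0.
  by rewrite ler_pdivlMr// ler_pdivrMr// ler_pdivrMr// ler_pdivlMr// ![_ * l]mulrC.
have lin a : 0 <= a <= pi / 2 -> (sin (s t) <= sin a <= sin s0) = (s t <= a <= s0).
  by move=> api; rewrite !leNgt !ltr_sin ?in_itv//=; lra.
rewrite sE; have [bp|bp] := leP b (pi / 2).
  by rewrite lin; [split; [by left|move=> [//|]; lra]|lra].
rewrite -(sin_pi b) lin; last by lra.
by split; [move=> h; right; lra|move=> [|]; lra].
Qed.

Lemma wedge_density_slice t : 0 < t < x ->
  (forall b, s t <= b <= s0 -> Y b = Y s0) ->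
  (forall b, pi - s0 <= b <= pi - s t -> Y b = Y (pi - s0)) ->
  wedge_density ga (x - t) x y1 y2 l =
  (Y s0)%:R * (wedge_prim s0 - wedge_prim (s t)) +
  (Y (pi - s0))%:R * (wedge_prim (pi - s t) - wedge_prim (pi - s0)).
Proof.
move=> tx Y1 Y2; have tx' : 0 <= t < x by lra.
have h1 := s_gt0 tx'; have h2 : 0 < s0 < pi / 2 by apply: s_gt0; rewrite lexx.
have pi0 := pi_gt0 R.
have st := s_lt tx.
have xt : 0 < x - t by lra.
pose f := wedge_integrand ga (x - t) x y1 y2 l.
have piece (a c : R) (e : bool) : a <= c -> 0 <= a -> c <= pi ->
    (forall b, a <= b <= c -> x - t <= l * sin b / sin ga <= x) ->
    (forall b, a <= b <= c -> Y b = e) ->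
    (\int[mu]_(b in `[a, c]) (f b)%:E = (e%:R * (wedge_prim c - wedge_prim a))%:E)%E.
  move=> ac a0 cpi sl Ye.
  have fE b : a <= b <= c -> f b = e%:R * w b.
    move=> abc; rewrite /f /wedge_integrand indicE -(Ye b abc); congr (_ %:R * _).
    congr nat_of_bool; apply/idP/idP; first by rewrite inE => -[].
    by move=> Yb; rewrite inE; split => //=; exact: sl.
  case: e Ye fE => [Ye fE|Ye fE].
    rewrite mul1r -(@integral_derive R wedge_prim w a c ac
      (fun b _ => @continuous_wedge_weight R ga b) (fun b _ => is_derive_wedge_prim b)).
    by apply: eq_integral => b; rewrite inE/= in_itv/= => /fE ->; rewrite mul1r.
  rewrite mul0r; apply: integral0_eq => b; rewrite /= in_itv/= => /fE ->.
  by rewrite mul0r.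
have P1 : (\int[mu]_(b in `[s t, s0]) (f b)%:E =
    ((Y s0)%:R * (wedge_prim s0 - wedge_prim (s t)))%:E)%E.
  apply: piece => //; [lra|lra|lra|].
  by move=> b bs; apply/(slice tx); [lra|left].
have P2 : (\int[mu]_(b in `[(pi - s0)%R, (pi - s t)%R]) (f b)%:E =
    ((Y (pi - s0))%:R * (wedge_prim (pi - s t) - wedge_prim (pi - s0)))%:E)%E.
  apply: piece => //; [lra|lra|lra|].
  by move=> b bs; apply/(slice tx); [lra|right].
suff : (wedge_density ga (x - t) x y1 y2 l)%:E =
  ((Y s0)%:R * (wedge_prim s0 - wedge_prim (s t)) +
   (Y (pi - s0))%:R * (wedge_prim (pi - s t) - wedge_prim (pi - s0)))%:E by case.
rewrite EFin_wedge_density// EFinD -P1 -P2.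
rewrite -ge0_integral_setU//; first last.
- by apply/disj_setPS => b [] /=; rewrite !in_itv/=; lra.
- by move=> b _; rewrite lee_fin wedge_integrand_ge0.
- by apply/measurable_EFinP; exact: measurable_wedge_integrand.
rewrite [LHS]integral_mkcond [RHS]integral_mkcond.
congr (integral _ _ _); apply/funext => b.
rewrite !patchE; have [bI|bI] := boolP (b \in _ `|` _).
  rewrite mem_set//; move: bI; rewrite inE => -[|] /=; rewrite !in_itv/=; lra.
case: ifPn => // bpi; rewrite /wedge_integrand indicE.
case: (boolP (_ \in _)); last by rewrite mul0r.
rewrite !inE/= in_itv/= in bpi * => -[/= /(slice tx bpi) sl _].
by exfalso; move: bI; rewrite notin_setE/= !in_itv/=; apply.
Qed.

(** The two intervals of directions shrink to [s0] and [pi - s0], near which the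
    condition on the second end of the chord is constant.  What remains is the
    derivative at [t = 0] of the antiderivative between the moving ends. *)
Lemma cvg_wedge_density_gt :
  l * sin (s0 - ga) / sin ga != y1 -> l * sin (s0 - ga) / sin ga != y2 ->
  l * sin (s0 + ga) / sin ga != y1 -> l * sin (s0 + ga) / sin ga != y2 ->
  t^-1 * wedge_density ga (x - t) x y1 y2 l @[t --> 0^'+] -->
  (Y s0)%:R * (w s0 * (sin ga / Num.sqrt (l ^+ 2 - (x * sin ga) ^+ 2))) +
  (Y (pi - s0))%:R * (w (pi - s0) * (sin ga / Num.sqrt (l ^+ 2 - (x * sin ga) ^+ 2))).
Proof.
move=> n1 n2 n3 n4.
have h2 : 0 < s0 < pi / 2 by apply: s_gt0; rewrite lexx.
have c0 : 0 < x * sin ga / l < 1 by have := c01 (t := 0); rewrite subr0; apply; rewrite lexx.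
set q := sin ga / _.
have ds : is_derive (0 : R) 1 s (- q).
  have d1 : is_derive (0 : R) 1 (fun t => (x - t) * sin ga / l) (- (sin ga / l)).
    by apply: is_derive_eq; rewrite /GRing.scale/=; ring.
  have d2 : is_derive ((x - 0) * sin ga / l) 1 (@asin R)
      (Num.sqrt (1 - ((x - 0) * sin ga / l) ^+ 2))^-1.
    by apply: is_derive1_asin; rewrite subr0; lra.
  have ds' : is_derive (0 : R) 1 s _ :=
    @is_derive1_comp R (@asin R) (fun t : R => (x - t) * sin ga / l) 0 _ _ d2 d1.
  apply: (is_derive_eq ds').
  rewrite /q subr0.
  have -> : 1 - (x * sin ga / l) ^+ 2 = (l ^+ 2 - (x * sin ga) ^+ 2) / l ^+ 2.
    by field; rewrite gt_eqF.
  have sq0 : 0 < Num.sqrt (l ^+ 2 - (x * sin ga) ^+ 2).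
    by rewrite sqrtr_gt0 subr_gt0 ltrXn2r// ?mulr_ge0 ?ltW.
  rewrite sqrtrM ?subr_ge0 ?lerXn2r ?nnegrE ?mulr_ge0 ?ltW//.
  rewrite sqrtrV ?exprn_ge0 ?ltW// sqrtr_sqr gtr0_norm//.
  by field; rewrite !gt_eqF.
have dF1 : is_derive (0 : R) 1 (fun t => wedge_prim (s t)) (w s0 * - q).
  exact: (@is_derive1_comp R wedge_prim s 0 _ _ (is_derive_wedge_prim s0) ds).
have dpi : is_derive (0 : R) 1 (fun t => pi - s t) q.
  by apply: is_derive_eq; ring.
have dF2 : is_derive (0 : R) 1 (fun t => wedge_prim (pi - s t)) (w (pi - s0) * q).
  exact: (@is_derive1_comp R wedge_prim (fun t => pi - s t) 0 _ _
    (is_derive_wedge_prim (pi - s0)) dpi).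
have l1 := cvg_right_quotient dF1.
have l2 := cvg_right_quotient dF2.
have lim12 : (Y s0)%:R * - (t^-1 * (wedge_prim (s t) - wedge_prim (s 0))) +
    (Y (pi - s0))%:R * (t^-1 * (wedge_prim (pi - s t) - wedge_prim (pi - s 0)))
    @[t --> 0^'+] -->
    (Y s0)%:R * (w s0 * q) + (Y (pi - s0))%:R * (w (pi - s0) * q).
  have nl1 := cvgN l1; rewrite mulrN opprK in nl1.
  apply: cvgD; apply: cvgM; [exact: cvg_cst|exact: nl1|exact: cvg_cst|exact: l2].
apply: cvg_trans lim12; apply: near_eq_cvg.
have cY (b : R) : {for b, continuous (fun b : R => l * sin (b - ga) / sin ga)}.
  apply: cvgM; last exact: cvg_cst.
  apply: cvgM; first exact: cvg_cst.
  apply: (@continuous_comp _ _ _ (fun b : R => b - ga) sin); last exact: continuous_sin.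
  by apply: cvgB; [exact: cvg_id|exact: cvg_cst].
have spE : sin (pi - s0 - ga) = sin (s0 + ga).
  by rewrite -[RHS]sin_pi; congr sin; ring.
have [r1 /= r10 Y1] := near_itv_cst (cY s0) n1 n2.
have [r2 /= r20 Y2] : \forall b \near pi - s0, Y b = Y (pi - s0).
  by apply: near_itv_cst; rewrite ?spE//; exact: cY.
have cs : s t @[t --> 0^'+] --> s0.
  apply: cvg_at_right_filter; apply: differentiable_continuous.
  by apply/derivable1_diffP; exact: (@ex_derive _ _ _ _ _ _ _ ds).
near=> t.
have tx : 0 < t < x.
  by apply/andP; split; [near: t; exact: nbhs_right_gt|near: t; exact: nbhs_right_lt].
have s1 : s0 - r1 < s t by near: t; apply: (cvgr_gt _ cs); lra.
have s2 : s0 - r2 < s t by near: t; apply: (cvgr_gt _ cs); lra.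
rewrite /= wedge_density_slice//.
- by rewrite -/s0; ring.
- by move=> b bs; apply: Y1 => /=; rewrite ltr_distlC; lra.
- by move=> b bs; apply: Y2 => /=; rewrite ltr_distlC; lra.
Unshelve. all: by end_near. Qed.

End wedge_limit.

(** * From directions to lengths in a strip *)

Section density_measure.
Context d (T : measurableType d) {R : realType}.
Variables (m : {measure set T -> \bar R}) (g : T -> \bar R).
Hypotheses (mg : measurable_fun setT g) (g0 : forall x, (0 <= g x)%E).

(** The positivity and measurability of [g] are arguments in order that the
    structure of measure can be attached to this function of sets. *)
Definition density_measure of measurable_fun setT g & (forall x, (0 <= g x)%E) :=
  fun A : set T => (\int[m]_(x in A) g x)%E.

Let nu := density_measure mg g0.

Let nu0 : nu set0 = 0%E. Proof. exact: integral_set0. Qed.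

Let nu_ge0 A : (0 <= nu A)%E. Proof. exact: integral_ge0. Qed.

Let nu_sigma_additive : semi_sigma_additive nu.
Proof.
move=> F mF tF mUF; rewrite /nu /density_measure ge0_integral_bigcup//.
  by apply: is_cvg_ereal_nneg_natsum_cond => n _ _; exact: integral_ge0.
exact: measurable_funS mg.
Qed.

HB.instance Definition _ := isMeasure.Build _ _ _ nu nu0 nu_ge0 nu_sigma_additive.

End density_measure.

Lemma ex_weighted_pushforward d1 d2 (T1 : measurableType d1) (T2 : measurableType d2)
    (R : realType) (m : {measure set T1 -> \bar R}) (D : set T1) (g : T1 -> R)
    (F : T1 -> T2) :
  measurable D -> measurable_fun D (g : T1 -> measurableTypeR R) ->
  (forall x, D x -> 0 <= g x) -> measurable_fun setT F ->
  exists nu : {measure set T2 -> \bar R}, forall A : set T2,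
    nu A = (\int[m]_(x in D) (g x * \1_A (F x))%:E)%E.
Proof.
move=> mD mg g0 mF.
have mgD : measurable_fun setT ((EFin \o g) \_ D).
  by apply/(measurable_restrictT _ _).1 => //; exact/measurable_EFinP.
have gD0 x : (0 <= ((EFin \o g) \_ D) x)%E.
  by apply: erestrict_ge0 => y Dy; rewrite lee_fin g0.
have [nu nuE] : exists nu : {measure set T1 -> \bar R},
    nu = density_measure m mgD gD0 :> (set _ -> _).
  by eexists.
have [nuF nuFE] : exists nuF : {measure set T2 -> \bar R},
    nuF = pushforward nu F :> (set _ -> _).
  by unshelve eexists (pushforward nu F).
exists nuF => A; rewrite nuFE nuE /pushforward /density_measure.
rewrite [LHS]integral_mkcond [RHS]integral_mkcond.
congr (integral _ _ _); apply/funext => x; rewrite !patchE indicE.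
have [xA|xA] := boolP (x \in F @^-1` A).
  have -> : F x \in A by move: xA; rewrite !inE.
  by rewrite mulr1.
have -> : (F x \in A) = false by apply: contraNF xA; rewrite !inE.
by rewrite mulr0; case: ifP.
Qed.

Section substitution.
Context {R : realType}.
Notation mR := (measurableTypeR R).
Notation mu := (@lebesgue_measure R).
Variable d : R.
Hypothesis d0 : 0 < d.

(** The density of [d / sin b] when [b] has the density [sin b] on
    [[0, pi / 2]]. *)
Definition strip_kernel (l : R) : R := d ^+ 2 / (l ^+ 2 * Num.sqrt (l ^+ 2 - d ^+ 2)).

Let sq_gt0 l : d < l -> 0 < l ^+ 2 - d ^+ 2.
Proof. by move=> dl; rewrite subr_gt0 ltrXn2r// ltW// (lt_trans d0). Qed.

Lemma strip_kernel_ge0 l : 0 <= strip_kernel l.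
Proof. by rewrite divr_ge0 ?sqr_ge0// mulr_ge0 ?sqr_ge0 ?sqrtr_ge0. Qed.

Lemma measurable_strip_kernel : measurable_fun setT (strip_kernel : mR -> mR).
Proof.
apply: measurable_funM => //; apply: measurable_fun_inv.
apply: measurable_funM; first exact: exprn_measurable.
apply: (@measurableT_comp _ _ _ _ _ _ (@Num.sqrt R : mR -> mR)).
  by apply: continuous_measurable_fun; exact: sqrt_continuous.
by apply: measurable_funB => //; exact: exprn_measurable.
Qed.

Lemma continuous_strip_kernel l : d < l -> {for l, continuous strip_kernel}.
Proof.
move=> dl; have l0 := lt_trans d0 dl.
apply: cvgM; first exact: cvg_cst.
apply: cvgV.
  by rewrite mulf_neq0 ?expf_neq0 ?gt_eqF// sqrtr_gt0 sq_gt0.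
apply: cvgM; first exact: exprn_continuous.
apply: (@continuous_comp _ _ _ (fun l : R => l ^+ 2 - d ^+ 2) Num.sqrt).
  by apply: cvgB; [exact: exprn_continuous|exact: cvg_cst].
exact: sqrt_continuous.
Qed.

(** This is [cos b] as a function of [l = d / sin b]. *)
Definition strip_prim (l : R) : R := Num.sqrt (1 - (d / l) ^+ 2).

Lemma is_derive_strip_prim (l : R) : d < l ->
  is_derive l 1 strip_prim (strip_kernel l).
Proof.
move=> dl; have l0 := lt_trans d0 dl.
have s0 := sq_gt0 dl.
have dl1 : is_derive l 1 (fun z : R => z^-1) (- l ^- 2).
  have := @is_deriveV R id l 1 1; rewrite /GRing.scale/= mulr1; apply.
    by rewrite gt_eqF.
have dp (y : R) : is_derive y 1 (fun z : R => 1 - d ^+ 2 * (z * z)) (- (2 * d ^+ 2 * y)).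
  by apply: is_derive_eq; rewrite /GRing.scale/=; ring.
have di : is_derive l 1 (fun z : R => 1 - (d * z^-1) ^+ 2) (2 * d ^+ 2 / l ^+ 3).
  rewrite (_ : (fun _ => _) = (fun z : R => 1 - d ^+ 2 * (z * z)) \o (fun z => z^-1)).
    apply: (is_derive_eq (@is_derive1_comp R _ (fun z : R => z^-1) l _ _ (dp l^-1) dl1)).
    by field; rewrite gt_eqF.
  by apply/funext => z; rewrite exprMn /= -expr2.
have sE : 1 - (d * l^-1) ^+ 2 = (l ^+ 2 - d ^+ 2) / l ^+ 2.
  by field; rewrite gt_eqF.
have i0 : 0 < 1 - (d * l^-1) ^+ 2 by rewrite sE divr_gt0// exprn_gt0.
have ds' : is_derive l 1 strip_prim _ :=
  @is_derive1_comp R (@Num.sqrt R) (fun z : R => 1 - (d * z^-1) ^+ 2) l _ _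
    (is_derive1_sqrt i0) di.
apply: (is_derive_eq ds').
rewrite sE sqrtrM ?ltW// sqrtrV ?sqr_ge0// sqrtr_sqr gtr0_norm// /strip_kernel.
have : 0 < Num.sqrt (l ^+ 2 - d ^+ 2) by rewrite sqrtr_gt0.
by move=> q0; field; rewrite !gt_eqF.
Qed.

Let mdsin : measurable_fun setT (fun b : mR => d / sin b : mR).
Proof.
apply: measurable_funM => //; apply: measurable_fun_inv.
exact: measurable_fun_sin.
Qed.

Lemma dsin_itv (a c b : R) : d < a -> a <= c -> 0 < b < pi / 2 ->
  (a < d / sin b <= c) = (asin (d / c) <= b < asin (d / a)).
Proof.
move=> da ac b0; have pi0 := pi_gt0 R.
have a0 := lt_trans d0 da; have c0 := lt_le_trans a0 ac.
have sb : 0 < sin b by apply: sin_gt0_pi; lra.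
have dx (z : R) : d < z -> 0 < d / z < 1.
  by move=> dz; rewrite divr_gt0 ?(lt_trans d0 dz)//= ltr_pdivrMr ?mul1r ?(lt_trans d0 dz).
have ax (z : R) : d < z -> - (pi / 2) <= asin (d / z) <= pi / 2.
  by move=> /dx dz; rewrite asin_geNpi2 ?asin_lepi2//; lra.
have hc := ax _ (lt_le_trans da ac); have ha := ax _ da.
have hc' := dx _ (lt_le_trans da ac); have ha' := dx _ da.
have e1 : (asin (d / c) <= b) = (d / c <= sin b).
  rewrite leNgt -(ltr_sin (x := b)) ?in_itv/=; try lra.
  by rewrite asinK ?in_itv/= -?leNgt//; lra.
have e2 : (b < asin (d / a)) = (sin b < d / a).
  rewrite -(ltr_sin (x := b)) ?in_itv/=; try lra.
  by rewrite asinK ?in_itv/=//; lra.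
rewrite e1 e2 andbC ler_pdivrMr// ltr_pdivlMr// ler_pdivrMr// ltr_pdivlMr//.
by rewrite ![_ * sin b]mulrC.
Qed.

Lemma strip_prim_asin (z : R) : d < z -> cos (asin (d / z)) = strip_prim z.
Proof.
move=> dz; have z0 := lt_trans d0 dz; rewrite cos_asin//.
rewrite ler_pdivrMr// mul1r (ltW dz) andbT.
by rewrite (le_trans _ (divr_ge0 (ltW d0) (ltW z0)))// lerN10.
Qed.

Let sin_itv (a c : R) : d < a -> a <= c ->
  (\int[mu]_(b in `]0%R, (pi / 2)%R[) (sin b * \1_(`]a, c]%classic : set R) (d / sin b))%:E =
   (strip_prim c - strip_prim a)%:E)%E.
Proof.
move=> da ac; have a0 := lt_trans d0 da; have c0 := lt_le_trans a0 ac.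
have pi0 := pi_gt0 R.
have dx (z : R) : d < z -> 0 < d / z < 1.
  by move=> dz; rewrite divr_gt0 ?(lt_trans d0 dz)//= ltr_pdivrMr ?mul1r ?(lt_trans d0 dz).
have dc := lt_le_trans da ac.
have ax (z : R) : d < z -> 0 < asin (d / z) < pi / 2.
  move=> /dx dz; rewrite asin_ltpi2 ?andbT; last by lra.
  have : - (pi / 2) <= asin (d / z) by apply: asin_geNpi2; lra.
  move=> ge; rewrite ltNge; apply/negP => le0.
  have : 0 <= sin (- asin (d / z)) by apply: sin_ge0_pi; lra.
  by rewrite sinN asinK ?in_itv/=; lra.
have ha := ax _ da; have hc := ax _ dc.
have le_ca : asin (d / c) <= asin (d / a).
  rewrite leNgt -ltr_sin ?in_itv/=; try lra.
  have ha' := dx _ da; have hc' := dx _ dc.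
  rewrite !asinK ?in_itv/=; try lra.
  by rewrite -leNgt ler_pM2l// lef_pV2.
transitivity (\int[mu]_(b in `[asin (d / c), asin (d / a)[) (sin b)%:E)%E.
  rewrite [LHS]integral_mkcond [RHS]integral_mkcond.
  congr (integral _ _ _); apply/funext => b; rewrite !patchE indicE.
  have [|nb] := boolP (b \in (`]0, pi / 2[%classic : set R)).
    rewrite inE/= in_itv/= => bb.
    have -> : (d / sin b \in (`]a, c]%classic : set R)) =
        (b \in (`[asin (d / c), asin (d / a)[%classic : set R)).
      by apply/idP/idP; rewrite !inE/= !in_itv/= dsin_itv.
    by case: ifP => _; rewrite ?mulr1 ?mulr0.
  rewrite ifF//; apply: contraNF nb; rewrite !inE/= !in_itv/=; lra.
rewrite integral_itv_bndo_bndc; last first.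
  by apply/measurable_EFinP; apply: measurable_fun_sin.
have dcos (b : R) : is_derive b 1 (fun b => - cos b) (sin b).
  by apply: is_derive_eq; rewrite opprK.
rewrite (@integral_derive R (fun b => - cos b) sin _ _ le_ca
  (fun b _ => @continuous_sin R b) (fun b _ => dcos b)).
by rewrite !strip_prim_asin// opprK addrC.
Qed.

Let ker_itv (a c : R) : d < a -> a <= c ->
  (\int[mu]_(l in `]d, +oo[) (strip_kernel l * \1_(`]a, c]%classic : set R) l)%:E =
   (strip_prim c - strip_prim a)%:E)%E.
Proof.
move=> da ac.
transitivity (\int[mu]_(l in `]a, c]) (strip_kernel l)%:E)%E.
  rewrite [LHS]integral_mkcond [RHS]integral_mkcond.
  congr (integral _ _ _); apply/funext => l; rewrite !patchE indicE.
  case: (boolP (l \in (`]a, c]%classic : set R))) => lac; last first.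
    by rewrite mulr0; case: ifP.
  rewrite mulr1 ifT//; move: lac; rewrite !inE/= !in_itv/= andbT; lra.
rewrite integral_itv_obnd_cbnd; last first.
  by apply/measurable_EFinP; apply: measurable_funTS; exact: measurable_strip_kernel.
have dl (l : R) : a <= l <= c -> d < l by lra.
exact: (@integral_derive R strip_prim strip_kernel _ _ ac
  (fun l lac => continuous_strip_kernel (dl l lac))
  (fun l lac => is_derive_strip_prim (dl l lac))).
Qed.

(** The substitution [l = d / sin b].  Both sides are measures in [A], and they
    agree on intervals by the fundamental theorem of calculus. *)
Lemma strip_substitution (A : set mR) : measurable A ->
  (\int[mu]_(b in `]0%R, (pi / 2)%R[) (sin b * \1_A (d / sin b))%:E =
   \int[mu]_(l in `]d, +oo[) (strip_kernel l * \1_A l)%:E)%E.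
Proof.
move=> mA; have pi0 := pi_gt0 R.
have [m1 m1E] : exists nu : {measure set mR -> \bar R}, forall A : set mR,
    nu A = (\int[mu]_(b in `]0%R, (pi / 2)%R[) (sin b * \1_A (d / sin b))%:E)%E.
  apply: ex_weighted_pushforward => //; first exact: measurable_fun_sin.
  by move=> b; rewrite /= in_itv/= => bb; apply: sin_ge0_pi; lra.
have [m2 m2E] : exists nu : {measure set mR -> \bar R}, forall A : set mR,
    nu A = (\int[mu]_(l in `]d, +oo[) (strip_kernel l * \1_A l)%:E)%E.
  apply: (@ex_weighted_pushforward _ _ _ _ _ _ _ _ (fun l : mR => l)) => //.
  - by apply: measurable_funTS; exact: measurable_strip_kernel.
  - by move=> l _; exact: strip_kernel_ge0.
rewrite -m1E -m2E.
have m12_gt (a c : R) : d < a -> m1 `]a, c]%classic = m2 `]a, c]%classic.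
  move=> da; have [ac|ca] := leP a c.
    by rewrite m1E m2E sin_itv// ker_itv.
  by rewrite set_itv_ge ?measure0// bnd_simp -leNgt ltW.
(* The kernel is unbounded near d, hence an increasing union. *)
have m12_d (c : R) : m1 `]d, c]%classic = m2 `]d, c]%classic.
  pose F n := `](d + n.+1%:R^-1), c]%classic : set mR.
  have FE : \bigcup_n F n = `]d, c]%classic.
    apply/seteqP; split => [z [n _]|z]; rewrite /F/= !in_itv/=.
      have : 0 < n.+1%:R^-1 :> R by [].
      by move: (n.+1%:R^-1 : R) => e; lra.
    move=> /andP[dz zc]; have [n nz] := ltr_add_invr dz.
    by exists n => //=; rewrite in_itv/= nz.
  have mF n : measurable (F n) by exact: measurable_itv.
  have mUF : measurable (\bigcup_n F n) by exact: bigcupT_measurable.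
  have ndF : nondecreasing_seq F.
    move=> n m nm; apply/subsetPset => z; rewrite /F/= !in_itv/=.
    have : m.+1%:R^-1 <= n.+1%:R^-1 :> R by rewrite lef_pV2 ?posrE// ler_nat.
    by move: (m.+1%:R^-1 : R) (n.+1%:R^-1 : R) => e1 e2; lra.
  have c1 := nondecreasing_cvg_mu (mu := m1) mF mUF ndF.
  have c2 := nondecreasing_cvg_mu (mu := m2) mF mUF ndF.
  have e12 : m1 \o F = m2 \o F.
    apply/funext => n /=; apply: m12_gt.
    have : 0 < n.+1%:R^-1 :> R by [].
    by move: (n.+1%:R^-1 : R) => e; lra.
  rewrite -FE; rewrite e12 in c1.
  exact: (cvg_unique _ c1 c2).
have m1d (B : set mR) : m1 B = m1 (B `&` `]d, +oo[%classic).
  rewrite !m1E; apply: eq_integral => b; rewrite inE/= in_itv/= => bb.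
  have sb : 0 < sin b by apply: sin_gt0_pi; lra.
  have dsb : d / sin b \in (`]d, +oo[%classic : set mR).
    rewrite inE/= in_itv/= andbT ltr_pdivlMr// gtr_pMr//.
    by rewrite -sin_pihalf ltr_sin ?in_itv/=; lra.
  by congr (_ * _)%:E; rewrite !indicE in_setI dsb andbT.
have m2d (B : set mR) : m2 B = m2 (B `&` `]d, +oo[%classic).
  rewrite !m2E; apply: eq_integral => l ld.
  by rewrite !indicE in_setI ld andbT.
apply: (@measure_unique _ R mR (@ocitv R)
  (fun n => `](1 *- n), n%:R]%classic) _ _ _ _ m1 m2 _ _ A mA).
- by [].
- exact: ocitvI.
- by move=> i; exact: is_ocitv.
- exact: (@bigcup_itvT R false false).
- move=> _ [[a c] _ <-] /=; have [da|ad] := ltP d a; first exact: m12_gt.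
  rewrite m1d m2d.
  have -> : `]a, c]%classic `&` `]d, +oo[%classic = `]d, c]%classic :> set mR.
    by apply/seteqP; split => z /=; rewrite !in_itv/= ?andbT; [case|]; lra.
  exact: m12_d.
- move=> n; rewrite m1E.
  apply: (@le_lt_trans _ _ (\int[mu]_(b in `]0%R, (pi / 2)%R[) (cst 1 b))%E).
    apply: ge0_le_integral => //.
    + move=> b; rewrite /= in_itv/= => bb; rewrite lee_fin mulr_ge0//.
      by apply: sin_ge0_pi; lra.
    + apply/measurable_EFinP; apply: measurable_funM; first exact: measurable_fun_sin.
      apply: (@measurableT_comp _ _ _ _ _ _
        (\1_(`](1 *- n), n%:R]%classic : set mR) : mR -> mR)).
        exact: measurable_indic.
      exact: measurable_funTS.
    + move=> b; rewrite /= in_itv/= => bb; rewrite lee_fin.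
      rewrite indicE; case: (_ \in _); rewrite ?mulr1 ?mulr0 ?sin_le1//.
  rewrite integral_cst// mul1e /= lebesgue_measure_itv/=.
  by case: ifP => _; rewrite ?ltry.
Qed.

End substitution.

(** * Chords of a strip *)

Section strip.
Context {R : realType}.
Notation mR := (measurableTypeR R).
Notation mu := (@lebesgue_measure R).
Variables (B : R * R) (om k d x0 x1 y1 y2 : R).
Hypotheses (k1 : `|k| = 1) (d0 : 0 < d) (x01 : x0 <= x1) (y12 : y1 <= y2).

Let w := dir om.
Let H := B + (k * d) *: dir (om + pi / 2).

Let kk : k * k = 1. Proof. by rewrite -expr2 -real_normK ?num_real// k1 expr1n. Qed.

Lemma strip_dist (x y : R) : eucl_dist (B + x *: w) (H + y *: w) =
  Num.sqrt (d ^+ 2 + (y - x) ^+ 2).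
Proof.
rewrite eucl_distE /H !vecE /w /dir/= sinDpihalf cosDpihalf; congr Num.sqrt.
transitivity ((cos om ^+ 2 + sin om ^+ 2) * (k * k * d ^+ 2 + (y - x) ^+ 2)).
  by ring.
by rewrite kk cos2Dsin2 !mul1r.
Qed.

(** The line meets the first side at the abscissa [q / sin b] and the second one
    [d cos b / sin b] further.  As abscissae may vanish, directions parallel to
    the strip have to be excluded explicitly. *)
Definition strip_set (E : set R) : set (mR * mR) :=
  [set z | [/\ sin z.2 != 0, x0 <= z.1 / sin z.2 <= x1,
     y1 <= (z.1 + d * cos z.2) / sin z.2 <= y2 & E (d / `|sin z.2|) ] ].

Lemma strip_chords E q b :
  chords (B + x1 *: w) (B + x0 *: w) (H + y1 *: w) (H + y2 *: w) E
    (straight_line (cross (dir (om + k * b)) B + (- k) * q, om + k * b)) <->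
  strip_set E (q, b).
Proof.
have cM x : straight_line (cross (dir (om + k * b)) B + (- k) * q, om + k * b)
    (B + x *: w) <-> x * sin b = q.
  rewrite straight_lineE crossDZr cross_dir.
  have -> : om - (om + k * b) = k * - b by ring.
  rewrite (sin_unit_mul k1) sinN; split => [|<-]; last by ring.
  move/addrI => xk.
  transitivity (- k * (- k * q)); last by rewrite mulrA mulrNN kk mul1r.
  rewrite -xk; transitivity (k * k * (x * sin b)); last by ring.
  by rewrite kk mul1r.
have cN y : straight_line (cross (dir (om + k * b)) B + (- k) * q, om + k * b)
    (H + y *: w) <-> y * sin b = q + d * cos b.
  rewrite straight_lineE /H 2!crossDZr !cross_dir.
  have -> : om - (om + k * b) = k * - b by ring.
  have -> : om + pi / 2 - (om + k * b) = k * - b + pi / 2 by ring.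
  rewrite sinDpihalf (sin_unit_mul k1) (cos_unit_mul k1) sinN cosN -addrA.
  split => [|yE]; last first.
    have -> : q = y * sin b - d * cos b by rewrite yE addrK.
    by ring.
  move/addrI => xk.
  have -> : q = - k * (- k * q) by rewrite mulrA mulrNN kk mul1r.
  rewrite -xk; transitivity (k * k * (y * sin b - d * cos b) + d * cos b); last by ring.
  by rewrite kk mul1r subrK.
have dE x y : x * sin b = q -> y * sin b = q + d * cos b -> sin b != 0 ->
    eucl_dist (B + x *: w) (H + y *: w) = d / `|sin b|.
  move=> xq yq s0; have -> : x = q / sin b by rewrite -xq mulfK.
  have -> : y = (q + d * cos b) / sin b by rewrite -yq mulfK.
  have -> : d / `|sin b| = `|d / sin b| by rewrite normrM normfV gtr0_norm.
  rewrite strip_dist -sqrtr_sqr; congr Num.sqrt.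
  transitivity (d ^+ 2 * (cos b ^+ 2 + sin b ^+ 2) / sin b ^+ 2).
    by field.
  by rewrite cos2Dsin2 mulr1 expr_div_n.
rewrite /chords /strip_set [segment (B + x1 *: _) _]segmentC/=; split.
- case=> M [N [/(segment_collinear _ _ _ x01)[x x01' ->]]].
  case/(segment_collinear _ _ _ y12) => y y12' -> /cM xq /cN yq.
  have s0 : sin b != 0.
    apply/eqP => s0; move: xq yq; rewrite s0 !mulr0 => <-.
    move/esym/eqP; rewrite add0r mulf_eq0 gt_eqF//= => /eqP cb.
    by have := cos2Dsin2 b; rewrite cb s0 expr0n addr0 => /eqP; rewrite eq_sym oner_eq0.
  rewrite (dE x y)// => El; split => //.
    by rewrite -xq mulfK.
  by rewrite -yq mulfK.
- case=> s0 xx yy El.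
  exists (B + (q / sin b) *: w), (H + ((q + d * cos b) / sin b) *: w); split.
  + by apply/segment_collinear => //; exists (q / sin b).
  + by apply/segment_collinear => //; exists ((q + d * cos b) / sin b).
  + by apply/cM; rewrite divfK.
  + by apply/cN; rewrite divfK.
  + by rewrite dE// divfK.
Qed.

Lemma measurable_strip_set (E : set mR) : measurable E -> measurable (strip_set E).
Proof.
move=> mE.
have mq : measurable_fun setT (fun z : mR * mR => z.1 : mR).
  exact: measurable_fst.
have mb : measurable_fun setT (fun z : mR * mR => z.2 : mR).
  exact: measurable_snd.
have ms : measurable_fun setT (fun z : mR * mR => sin z.2 : mR).
  exact: measurable_fun_sin.
have mc : measurable_fun setT (fun z : mR * mR => cos z.2 : mR).
  exact: measurable_fun_cos.
have -> : strip_set E =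
    ((fun z : mR * mR => sin z.2 : mR) @^-1` [set~ 0]) `&`
    [set z | x0 <= z.1 / sin z.2 <= x1] `&`
    [set z | y1 <= (z.1 + d * cos z.2) / sin z.2 <= y2] `&`
    (fun z => d / `|sin z.2| : mR) @^-1` E.
  apply/seteqP; split => z /=; first by move=> [/eqP a b c e].
  by move=> [[[a b] c] e]; split => //; exact/eqP.
apply: measurableI; [apply: measurableI; [apply: measurableI|]|].
- rewrite -[X in measurable X]setTI; apply: ms => //.
  by apply: measurableC; exact: measurable_set1.
- apply: measurable_fun_itvcc; apply: measurable_funM => //.
  exact: measurable_fun_inv.
- apply: measurable_fun_itvcc; apply: measurable_funM => //.
    by apply: measurable_funD => //; apply: measurable_funM.
  exact: measurable_fun_inv.
- rewrite -[X in measurable X]setTI.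
  suff : measurable_fun setT (fun z : mR * mR => d / `|sin z.2| : mR) by exact.
  apply: measurable_funM => //; apply: measurable_fun_inv.
  apply: (@measurableT_comp _ _ _ _ _ _ (fun x : mR => `|x| : mR)) => //.
  exact: normr_measurable.
Qed.

Let Y : set mR := `[y1, y2]%classic.

Definition strip_integrand (E : set mR) (b x : R) : R :=
  sin b * (\1_E (d / sin b) * \1_Y (x + d * (cos b / sin b))).

(** In a given direction [q] is proportional to the abscissa of the first end of
    the chord. *)
Lemma strip_section (E : set mR) b : measurable E -> 0 <= b < pi ->
  (mu (ysection (strip_set E) b) =
   \int[mu]_(x in `[x0, x1]) (strip_integrand E b x)%:E)%E.
Proof.
move=> mE b0pi; have sb : 0 <= sin b by apply: sin_ge0_pi; lra.
have [s0|s0] := eqVneq (sin b) 0.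
  have -> : ysection (strip_set E) b = set0.
    by apply/seteqP; split => q //=; rewrite /ysection/= inE => -[/=]; rewrite s0 eqxx.
  rewrite measure0 integral0_eq// => x _.
  by rewrite /strip_integrand s0 mul0r.
have {}sb : 0 < sin b by rewrite lt_neqAle eq_sym s0.
rewrite (@lebesgue_measure_affine R (sin b) 0)//; last first.
  by apply: measurable_ysection; exact: measurable_strip_set.
rewrite gtr0_norm//.
pose X := [set x : mR | Y (x + d * (cos b / sin b))].
have mX : measurable X.
  have -> : X = (fun x : R => 1 * x + d * (cos b / sin b)) @^-1` Y.
    by apply/seteqP; split => x; rewrite /X/= mul1r.
  rewrite -[X in measurable X]setTI.
  by apply: measurable_affine => //; exact: measurable_itv.
have iE x : strip_integrand E b x = (sin b * \1_E (d / sin b)) * \1_X x.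
  have YX : (x + d * (cos b / sin b) \in Y) = (x \in X).
    by apply/idP/idP; rewrite !inE.
  by rewrite /strip_integrand -[RHS]mulrA !indicE YX.
under eq_integral do rewrite iE EFinM.
rewrite ge0_integralZl//; last 2 first.
- by apply/measurable_EFinP/measurable_funTS; exact: measurable_indic.
- by rewrite lee_fin mulr_ge0// ltW.
rewrite integral_indic// EFinM -muleA; congr (_ * _)%E.
have preE : (fun x : R => sin b * x + 0) @^-1` ysection (strip_set E) b =
    [set x | E (d / sin b) /\ (X `&` `[x0, x1]) x].
  apply/seteqP; split => x /=; rewrite /ysection/= inE/= /strip_set/= addr0.
    rewrite [sin b * x]mulrC mulfK// mulrDl mulfK// gtr0_norm// -mulrA.
    by move=> [_ xx yy EE]; split => //; split; rewrite /X/Y/= in_itv.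
  rewrite [sin b * x]mulrC mulfK// mulrDl mulfK// gtr0_norm// -mulrA.
  by rewrite /X/Y/= !in_itv/= => -[EE [yy xx]]; split.
rewrite preE indicE; have [EE|EE] := boolP (d / sin b \in E).
  rewrite mul1e; congr (mu _); rewrite inE in EE.
  by apply/seteqP; split => x /=; [case|].
rewrite mul0e [X in mu X](_ : _ = set0) ?measure0//.
by apply/seteqP; split => x //= -[EE' _]; move: EE; rewrite notin_setE.
Qed.

End strip.

(** * Density of the chord lengths of a strip *)

Section strip_density.
Context {R : realType}.
Notation mR := (measurableTypeR R).
Notation mu := (@lebesgue_measure R).
Variables (B : R * R) (om k d x0 x1 y1 y2 : R).
Hypotheses (k1 : `|k| = 1) (d0 : 0 < d) (x01 : x0 <= x1) (y12 : y1 <= y2).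

Let w := dir om.
Let H := B + (k * d) *: dir (om + pi / 2).
Let Y : set mR := `[y1, y2]%classic.
Let root (l : R) := Num.sqrt (l ^+ 2 - d ^+ 2).

Let mroot : measurable_fun setT (root : mR -> mR).
Proof.
apply: (@measurableT_comp _ _ _ _ _ _ (@Num.sqrt R : mR -> mR)).
  by apply: continuous_measurable_fun; exact: sqrt_continuous.
by apply: measurable_funB => //; exact: exprn_measurable.
Qed.

(** The lengths of the chords that start at the abscissa [x] and end in the second
    segment after leaning forward ([e = 1]) or backward ([e = -1]). *)
Let far (E : set mR) (x e : R) : set mR := [set l | E l /\ Y (x + e * root l)].

Let mfar E x e : measurable E -> measurable (far E x e).
Proof.
move=> mE; have -> : far E x e = E `&` (fun l : mR => x + e * root l : mR) @^-1` Y by [].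
apply: measurableI => //; rewrite -[X in measurable X]setTI.
have : measurable_fun setT (fun l : mR => x + e * root l : mR).
  by apply: measurable_funD => //; apply: measurable_funM.
by apply => //; exact: measurable_itv.
Qed.

Let far_indic (E : set mR) (x e b : R) : 0 < b < pi / 2 ->
  \1_(far E x e) (d / sin b) =
  \1_E (d / sin b) * \1_Y (x + e * (d * (cos b / sin b))) :> R.
Proof.
move=> b0; have pi0 := pi_gt0 R.
have sb : 0 < sin b by apply: sin_gt0_pi; lra.
have cb : 0 < cos b by apply: cos_gt0_pihalf; lra.
have -> : d * (cos b / sin b) = root (d / sin b).
  rewrite /root -[LHS]ger0_norm; last by rewrite mulr_ge0 ?divr_ge0 ?ltW.
  rewrite -sqrtr_sqr; congr Num.sqrt.
  by rewrite !exprMn cos2sin2; field; rewrite gt_eqF.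
rewrite !indicE -natrM mulnb; congr (nat_of_bool _)%:R.
by apply/idP/andP; rewrite !inE.
Qed.

Let half (E : set mR) (x e : R) : measurable E ->
  (\int[mu]_(b in `]0%R, (pi / 2)%R[)
     (sin b * (\1_E (d / sin b) * \1_Y (x + e * (d * (cos b / sin b)))))%:E =
   \int[mu]_(l in `]d, +oo[) (strip_kernel d l * \1_(far E x e) l)%:E)%E.
Proof.
move=> mE; rewrite -strip_substitution//; last exact: mfar.
by apply: eq_integral => b; rewrite inE/= in_itv/= => bb; rewrite far_indic.
Qed.

Lemma measurable_strip_integrand (E : set mR) : measurable E ->
  measurable_fun setT (fun z : mR * mR => (strip_integrand d y1 y2 E z.1 z.2)%:E).
Proof.
move=> mE; apply/measurable_EFinP.
have m1 : measurable_fun setT (fun z : mR * mR => z.1 : mR) := measurable_fst.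
have m2 : measurable_fun setT (fun z : mR * mR => z.2 : mR) := measurable_snd.
apply: measurable_funM; first exact: measurable_fun_sin.
apply: measurable_funM.
  apply: (@measurableT_comp _ _ _ _ _ _ (\1_E : mR -> mR)); first exact: measurable_indic.
  by apply: measurable_funM => //; apply: measurable_fun_inv; exact: measurable_fun_sin.
apply: (@measurableT_comp _ _ _ _ _ _ (\1_Y : mR -> mR)).
  by apply: measurable_indic; exact: measurable_itv.
apply: measurable_funD => //; apply: measurable_funM => //; apply: measurable_funM.
  exact: measurable_fun_cos.
by apply: measurable_fun_inv; exact: measurable_fun_sin.
Qed.

Lemma strip_integrand_ge0 (E : set mR) (b x : R) : 0 <= b <= pi ->
  0 <= strip_integrand d y1 y2 E b x.
Proof. by move=> bpi; rewrite /strip_integrand !mulr_ge0// sin_ge0_pi. Qed.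

(** When the first end is fixed, the acute directions give the chords that lean
    forward and the obtuse ones those that lean backward. *)
Let turn (E : set mR) (x : R) : measurable E ->
  (\int[mu]_(b in `[0%R, pi[) (strip_integrand d y1 y2 E b x)%:E =
   \int[mu]_(l in `]d, +oo[) (strip_kernel d l * \1_(far E x 1) l)%:E +
   \int[mu]_(l in `]d, +oo[) (strip_kernel d l * \1_(far E x (-1)) l)%:E)%E.
Proof.
move=> mE; have pi0 := pi_gt0 R.
have mS : measurable_fun setT (fun b : mR => (strip_integrand d y1 y2 E b x)%:E).
  exact: (measurableT_comp (measurable_strip_integrand mE) (measurable_pair2 x)).
have -> : `[0, pi[%classic = `[0, pi / 2[ `|` `[pi / 2, pi[ :> set mR.
  apply/seteqP; split => b /=; rewrite !in_itv/=; last by case; lra.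
  by move=> bb; have [?|?] := ltP b (pi / 2); [left|right]; lra.
rewrite ge0_integral_setU//=; last 3 first.
- exact: measurable_funS mS.
- by move=> b [] /=; rewrite in_itv/= => bb; rewrite lee_fin strip_integrand_ge0//; lra.
- by apply/disj_setPS => b [] /=; rewrite !in_itv/=; lra.
congr (_ + _)%E.
  rewrite -integral_itv_obnd_cbnd; last exact: measurable_funS mS.
  rewrite -half//; apply: eq_integral => b _; by rewrite mul1r.
rewrite -half//.
rewrite [LHS](@ge0_integral_affine_set R (-1) pi)// ?oppr_eq0 ?oner_neq0//; last first.
  by move=> b /=; rewrite in_itv/= => bb; rewrite lee_fin strip_integrand_ge0//; lra.
rewrite normrN normr1 mul1e.
have -> : (fun b : R => -1 * b + pi) @^-1` `[pi / 2, pi[%classic = `]0, pi / 2]%classic.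
  by apply/seteqP; split => b /=; rewrite !in_itv/=; lra.
have mS' : measurable_fun setT
    (fun b : mR => (strip_integrand d y1 y2 E (-1 * b + pi) x)%:E).
  exact: (measurableT_comp mS (measurable_affine (-1) pi)).
rewrite -integral_itv_bndo_bndc; last exact: measurable_funS mS'.
apply: eq_integral => b _; rewrite /strip_integrand mulN1r addrC.
have -> : sin (pi - b) = sin b by rewrite sinB sinpi cospi; ring.
have -> : cos (pi - b) = - cos b by rewrite cosB sinpi cospi; ring.
by have -> : x + d * (- cos b / sin b) = x + -1 * (d * (cos b / sin b)) by ring.
Qed.

(** The measure of the first ends that a translation by [s] sends into the second
    segment. *)
Definition overlap (s : R) : R :=
  Num.max 0 (Num.min x1 (y2 - s) - Num.max x0 (y1 - s)).

Let overlapE (s : R) :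
  (\int[mu]_(x in `[x0, x1]) (\1_Y (x + s))%:E = (overlap s)%:E)%E.
Proof.
pose X : set mR := `[y1 - s, y2 - s]%classic.
transitivity (\int[mu]_(x in `[x0, x1]) (\1_X x)%:E)%E.
  apply: eq_integral => x _; rewrite !indicE; congr (nat_of_bool _)%:R%:E.
  by apply/idP/idP; rewrite !inE /X /Y/= !in_itv/=; lra.
rewrite integral_indic//; last exact: measurable_itv.
have -> : X `&` `[x0, x1] = `[Num.max x0 (y1 - s), Num.min x1 (y2 - s)]%classic.
  apply/seteqP; split => x /=; rewrite /X/= !in_itv/= ge_max le_min.
    by move=> [/andP[-> ->] /andP[-> ->]].
  by move=> /andP[/andP[-> ->] /andP[-> ->]].
rewrite /= lebesgue_measure_itv/= lte_fin /overlap.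
case: ltP => h.
  by rewrite -EFinB; congr EFin; apply/esym/max_r; rewrite subr_ge0 ltW.
by congr EFin; apply/esym/max_l; rewrite subr_le0.
Qed.

Lemma overlap_ge0 s : 0 <= overlap s.
Proof. by rewrite le_max lexx. Qed.

Lemma continuous_overlap : continuous overlap.
Proof.
move=> s.
have cmax (f g : R -> R) : {for s, continuous f} -> {for s, continuous g} ->
    {for s, continuous (fun s => Num.max (f s) (g s))}.
  by move=> cf cg; exact: (@continuous_max R R f g s).
have cmin (f g : R -> R) : {for s, continuous f} -> {for s, continuous g} ->
    {for s, continuous (fun s => Num.min (f s) (g s))}.
  by move=> cf cg; exact: (@continuous_min R R f g s).
have csub (c : R) : {for s, continuous (fun s => c - s)}.
  by apply: cvgB; [exact: cvg_cst|exact: cvg_id].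
apply: (cmax (fun=> 0)); first exact: cvg_cst.
apply: cvgB; first by apply: (cmin (fun=> x1)); [exact: cvg_cst|exact: csub].
by apply: (cmax (fun=> x0)); [exact: cvg_cst|exact: csub].
Qed.

Definition strip_density (l : R) : R :=
  if d < l then strip_kernel d l * (overlap (root l) + overlap (- root l)) else 0.

Let layer_fun (E : set mR) (e : R) (z : mR * mR) : \bar R :=
  (strip_kernel d z.2 * (\1_E z.2 * \1_Y (z.1 + e * root z.2)))%:E.

Let layer_funE E x e l :
  (strip_kernel d l * \1_(far E x e) l)%:E = layer_fun E e (x, l).
Proof.
rewrite /layer_fun/= !indicE -natrM mulnb; congr (_ * (nat_of_bool _)%:R)%:E.
by apply/idP/andP; rewrite !inE.
Qed.

Let layer_ge0 E e z : (0 <= layer_fun E e z)%E.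
Proof. by rewrite lee_fin mulr_ge0 ?strip_kernel_ge0// mulr_ge0. Qed.

Let measurable_layer (E : set mR) (e : R) : measurable E ->
  measurable_fun setT (layer_fun E e).
Proof.
move=> mE.
have m1 : measurable_fun setT (fun z : mR * mR => z.1 : mR) := measurable_fst.
have m2 : measurable_fun setT (fun z : mR * mR => z.2 : mR) := measurable_snd.
apply/measurable_EFinP; apply: measurable_funM.
  exact: (measurableT_comp (measurable_strip_kernel d) m2).
apply: measurable_funM.
  by apply: (@measurableT_comp _ _ _ _ _ _ (\1_E : mR -> mR)) => //; exact: measurable_indic.
apply: (@measurableT_comp _ _ _ _ _ _ (\1_Y : mR -> mR)).
  by apply: measurable_indic; exact: measurable_itv.
apply: measurable_funD => //; apply: measurable_funM => //.
exact: (measurableT_comp mroot m2).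
Qed.

Let measurable_layer_section (E : set mR) (e : R) : measurable E ->
  measurable_fun setT (fun x : mR => \int[mu]_(l in `]d, +oo[)
     (strip_kernel d l * \1_(far E x e) l)%:E)%E.
Proof.
move=> mE; pose F := layer_fun E e \_ (setT `*` (`]d, +oo[%classic : set mR)).
rewrite (_ : (fun x : mR => _) = fubini_F mu F); last first.
  apply/funext => x; rewrite /fubini_F [LHS]integral_mkcond.
  congr (integral _ _ _); apply/funext => l.
  by rewrite /F !patchE in_setX in_setT/= layer_funE.
apply: measurable_fun_fubini_tonelli_F; last exact: erestrict_ge0.
apply/(measurable_restrictT _ _).1; first by apply: measurableX => //; exact: measurable_itv.
by apply: measurable_funTS; exact: measurable_layer.
Qed.

Let half_density (e l : R) : R :=
  if d < l then strip_kernel d l * overlap (e * root l) else 0.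

Let half_density_ge0 e l : 0 <= half_density e l.
Proof.
by rewrite /half_density; case: ifP => // _; rewrite mulr_ge0 ?strip_kernel_ge0 ?overlap_ge0.
Qed.

Let measurable_half_density e (A : set mR) :
  measurable_fun A (fun l : mR => (half_density e l)%:E).
Proof.
apply/measurable_EFinP/measurable_funTS.
rewrite (_ : half_density e = fun l => strip_kernel d l * overlap (e * root l) *
    \1_(`]d, +oo[%classic : set mR) l); last first.
  apply/funext => l; rewrite /half_density indicE.
  have -> : (l \in (`]d, +oo[%classic : set mR)) = (d < l).
    by apply/idP/idP; rewrite inE/= in_itv/= andbT.
  by case: ifP; rewrite ?mulr1 ?mulr0.
apply: measurable_funM; last by apply: measurable_indic; exact: measurable_itv.
apply: measurable_funM; first exact: measurable_strip_kernel.
apply: (@measurableT_comp _ _ _ _ _ _ (overlap : mR -> mR)).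
  by apply: continuous_measurable_fun; exact: continuous_overlap.
by apply: measurable_funM.
Qed.

Let layer (E : set mR) (e : R) : measurable E ->
  (\int[mu]_(x in `[x0, x1]) \int[mu]_(l in `]d, +oo[)
     (strip_kernel d l * \1_(far E x e) l)%:E =
   \int[mu]_(l in E) (half_density e l)%:E)%E.
Proof.
move=> mE; pose F := layer_fun E e.
have mF := measurable_layer e mE.
under eq_integral => x _ do under eq_integral => l _ do rewrite layer_funE.
rewrite (@tonelli_sets _ _ _ _ _ mu mu _ _ F)//; last first.
  by move=> x l _ _; exact: layer_ge0.
rewrite [LHS]integral_mkcond [RHS]integral_mkcond.
congr (integral _ _ _); apply/funext => l; rewrite !patchE /half_density.
have [dl|ld] := boolP (d < l); last first.
  rewrite ifF; last by apply/negbTE; rewrite notin_setE/= in_itv/= andbT; exact/negP.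
  by case: ifP.
rewrite ifT; last by rewrite inE/= in_itv/= dl.
have [lE|lE] := boolP (l \in E); last first.
  apply: integral0_eq => x _; rewrite /F/layer_fun/= indicE (negbTE lE).
  by rewrite mul0r mulr0.
rewrite /F/layer_fun/=; under eq_integral => x _ do rewrite indicE lE mul1r EFinM.
rewrite ge0_integralZl//; last 2 first.
- apply/measurable_EFinP/measurable_funTS.
  apply: (@measurableT_comp _ _ _ _ _ _ (\1_Y : mR -> mR)).
    by apply: measurable_indic; exact: measurable_itv.
  by apply: measurable_funD.
- by rewrite lee_fin strip_kernel_ge0.
by rewrite overlapE -EFinM.
Qed.

Lemma line_measure_strip (E : set mR) : measurable E -> E `<=` `]0, +oo[ ->
  line_measure (chords (B + x1 *: w) (B + x0 *: w) (H + y1 *: w) (H + y2 *: w) E) =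
  (\int[mu]_(l in E) (strip_density l)%:E)%E.
Proof.
move=> mE E0; have pi0 := pi_gt0 R.
rewrite (@line_measure_polar R _ om k (- k)
  (fun b => cross (dir (om + k * b)) B) (strip_set d x0 x1 y1 y2 E))//; last 4 first.
- by rewrite normrN.
- have mb : measurable_fun setT ((fun b => om + k * b) : mR -> mR).
    by apply: measurable_funD => //; apply: measurable_funM.
  by apply: measurable_funB; apply: measurable_funM => //;
    [exact: measurable_fun_cos|exact: measurable_fun_sin].
- exact: measurable_strip_set.
- by move=> q b; exact: strip_chords.
transitivity (\int[mu]_(b in `[0%R, pi[)
    \int[mu]_(x in `[x0, x1]) (strip_integrand d y1 y2 E b x)%:E)%E.
  apply: eq_integral => b; rewrite inE/= in_itv/= => b0pi.
  exact: strip_section.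
rewrite (@tonelli_sets _ _ _ _ _ mu mu _ _
  (fun z => (strip_integrand d y1 y2 E z.1 z.2)%:E))//; last 2 first.
- exact: measurable_strip_integrand.
- move=> b x /=; rewrite !in_itv/= => bb _.
  by rewrite lee_fin strip_integrand_ge0//; lra.
under eq_integral => x _ do rewrite turn//.
rewrite ge0_integralD//; first last.
- by apply: measurable_funTS; exact: measurable_layer_section.
- by move=> x _; apply: integral_ge0 => l _; rewrite layer_funE.
- by apply: measurable_funTS; exact: measurable_layer_section.
- by move=> x _; apply: integral_ge0 => l _; rewrite layer_funE.
rewrite !layer// -ge0_integralD//; first last.
- by move=> l _; rewrite lee_fin half_density_ge0.
- by move=> l _; rewrite lee_fin half_density_ge0.
apply: eq_integral => l _; rewrite -EFinD /strip_density /half_density; congr EFin.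
by case: ifPn => _; rewrite ?addr0// mul1r mulN1r mulrDr.
Qed.

Lemma continuous_strip_density l : 0 < l -> l != d -> {for l, continuous strip_density}.
Proof.
move=> l0; rewrite neq_lt => /orP[ld|dl].
  apply: cvg_near_cst; near=> z.
  have zd : z < d by near: z; exact: (cvgr_lt l cvg_id).
  by rewrite /strip_density (lt_gtF ld) (lt_gtF zd).
have near_eq : \forall z \near l,
    strip_kernel d z * (overlap (root z) + overlap (- root z)) = strip_density z.
  near=> z; have dz : d < z by near: z; exact: (cvgr_gt l cvg_id).
  by rewrite /strip_density dz.
have croot : {for l, continuous root}.
  apply: (@continuous_comp _ _ _ (fun l : R => l ^+ 2 - d ^+ 2) Num.sqrt).
    by apply: cvgB; [exact: exprn_continuous|exact: cvg_cst].
  exact: sqrt_continuous.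
apply: cvg_trans (near_eq_cvg near_eq) _.
rewrite /strip_density dl; apply: cvgM; first exact: continuous_strip_kernel.
apply: cvgD.
  by apply: (@continuous_comp _ _ _ root overlap) => //; exact: continuous_overlap.
apply: (@continuous_comp _ _ _ (fun z => - root z) overlap).
  by apply: cvgN; exact: croot.
exact: continuous_overlap.
Unshelve. all: by end_near. Qed.

Lemma measurable_strip_density : measurable_fun setT (strip_density : mR -> mR).
Proof.
rewrite (_ : strip_density = (half_density 1 \+ half_density (-1))); last first.
  apply/funext => l; rewrite /strip_density /half_density/=.
  by case: ifPn => _; rewrite ?addr0// mul1r mulN1r mulrDr.
by apply: measurable_funD; apply/measurable_EFinP; exact: measurable_half_density.
Qed.

Lemma chord_length_density_strip :
  chord_length_density (B + x1 *: w) (B + x0 *: w) (H + y1 *: w) (H + y2 *: w)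
    strip_density.
Proof.
split; last by move=> E mE E0; rewrite line_measure_strip.
by apply: measurable_funTS; exact: measurable_strip_density.
Qed.

End strip_density.

(** * Short segments in a strip *)

Section strip_rho.
Context {R : realType}.
Variables (B : R * R) (om k d y1 y2 : R).
Hypotheses (k1 : `|k| = 1) (d0 : 0 < d).

Let w := dir om.
Let H := B + (k * d) *: dir (om + pi / 2).
Let root (l : R) := Num.sqrt (l ^+ 2 - d ^+ 2).

Lemma line_through_collinear (P u : R * R) (a b : R) (X : R * R) : 
  line_through (P + a *: u) (P + b *: u) X -> exists x, X = P + x *: u.
Proof.
by case=> t ->; exists (a + t * (b - a)); apply: vec_eq; rewrite !vecE; ring.
Qed.

Lemma collinear_line_through (P u : R * R) (a b x : R) : a != b ->
  line_through (P + a *: u) (P + b *: u) (P + x *: u).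
Proof.
move=> ab; exists ((x - a) / (b - a)).
have ba : b - a != 0 by rewrite subr_eq0 eq_sym.
by apply: vec_eq; rewrite !vecE; field.
Qed.

Lemma set_dist_strip (x1 x2 z1 z2 : R) : x1 != x2 ->
  set_dist (line_through (B + x1 *: w) (B + x2 *: w))
           (line_through (H + z1 *: w) (H + z2 *: w)) = d.
Proof.
move=> x12; rewrite /set_dist; set S := [set _ | _].
have dS : lbound S d.
  move=> _ [X [Y [/line_through_collinear[x ->] [/line_through_collinear[y ->] ->]]]].
  by rewrite strip_dist// -{1}(gtr0_norm d0) -sqrtr_sqr ler_wsqrtr// lerDl sqr_ge0.
have Sd : S d.
  exists (B + z1 *: w), (H + z1 *: w); split; [|split].
  - exact: collinear_line_through.
  - by exists 0; rewrite scale0r addr0.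
  - by rewrite strip_dist// subrr expr0n addr0 sqrtr_sqr gtr0_norm.
apply/le_anti/andP; split; first by apply: ge_inf => //; exists d.
by apply: lb_le_inf => //; exists d.
Qed.

Lemma rho_strip (x0 x1 l : R) : 0 < l -> l != d -> x0 < x1 -> y1 <= y2 ->
  rho (B + x1 *: w) (B + x0 *: w) (H + y1 *: w) (H + y2 *: w) l =
  strip_density d x0 x1 y1 y2 l.
Proof.
move=> l0 ld lt_x y12; have x10 : x1 != x0 by rewrite gt_eqF.
apply: rho_eq => //.
- by apply: chord_length_density_strip => //; exact: ltW.
- move=> z z0; rewrite set_dist_strip// => nzd.
  apply: continuous_strip_density => //; apply/eqP => zd; apply: nzd; split => //.
  by rewrite /parallel /cross !vecE; ring.
- by rewrite set_dist_strip// => -[_ /eqP]; rewrite (negbTE ld).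
Qed.

(** Unless [x + s] is an end of [[y1, y2]], the interval [[x - t, x]] translated
    by [s] is eventually inside or outside of it. *)
Lemma cvg_overlap (x s : R) : x + s != y1 -> x + s != y2 -> y1 <= y2 ->
  t^-1 * overlap (x - t) x y1 y2 s @[t --> 0^'+] --> ((y1 <= x + s <= y2)%R%:R : R).
Proof.
move=> n1 n2 y12; apply: cvg_near_cst.
have nt (e : R) : 0 < e -> \forall t \near (0 : R)^'+, t < e.
  by move=> e0; exact: nbhs_right_lt.
have [lt1|lt1|/eqP] := ltgtP (x + s) y1; last by rewrite (negbTE n1).
  near=> t; have t0 : 0 < t by near: t; exact: nbhs_right_gt.
  rewrite (_ : overlap _ _ _ _ _ = 0) ?mulr0//.
  apply/max_l; rewrite subr_le0 ge_min !le_max; apply/orP; left.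
  by apply/orP; right; lra.
have [lt2|lt2|/eqP] := ltgtP (x + s) y2; last by rewrite (negbTE n2).
  near=> t; have t0 : 0 < t by near: t; exact: nbhs_right_gt.
  have ts : t < x + s - y1 by near: t; apply: nt; lra.
  rewrite /overlap (min_l (y := y2 - s)); last lra.
  rewrite (max_l (y := y1 - s)); last lra.
  rewrite (_ : x - (x - t) = t); last ring.
  by rewrite max_r ?ltW// mulVf// gt_eqF.
near=> t; have t0 : 0 < t by near: t; exact: nbhs_right_gt.
have ts : t < x + s - y2 by near: t; apply: nt; lra.
rewrite (_ : overlap _ _ _ _ _ = 0) ?mulr0//.
apply/max_l; rewrite subr_le0 ge_min !le_max; apply/orP; right.
by apply/orP; left; lra.
Unshelve. all: by end_near. Qed.

Lemma cvg_strip_density_lt (x l : R) : l < d ->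
  t^-1 * strip_density d (x - t) x y1 y2 l @[t --> 0^'+] --> 0.
Proof.
move=> ld; apply: cvg_near_cst; near=> t.
by rewrite /strip_density (lt_gtF ld) mulr0.
Unshelve. all: by end_near. Qed.

Lemma cvg_strip_density_gt (x l : R) : d < l -> y1 <= y2 ->
  x + root l != y1 -> x + root l != y2 -> x - root l != y1 -> x - root l != y2 ->
  t^-1 * strip_density d (x - t) x y1 y2 l @[t --> 0^'+] -->
  strip_kernel d l * ((y1 <= x + root l <= y2)%R%:R + (y1 <= x - root l <= y2)%R%:R).
Proof.
move=> dl y12 n1 n2 n3 n4.
have c1 := cvg_overlap n1 n2 y12; have c2 := cvg_overlap n3 n4 y12.
have lim : strip_kernel d l * (t^-1 * overlap (x - t) x y1 y2 (root l) +
    t^-1 * overlap (x - t) x y1 y2 (- root l)) @[t --> 0^'+] -->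
    strip_kernel d l * ((y1 <= x + root l <= y2)%R%:R + (y1 <= x - root l <= y2)%R%:R).
  apply: cvgM; first exact: cvg_cst.
  by apply: cvgD; [exact: c1|exact: c2].
apply: cvg_trans lim; apply: near_eq_cvg; near=> t.
by rewrite /strip_density dl -/(root l); ring.
Unshelve. all: by end_near. Qed.

End strip_rho.

(** * Exceptional lengths *)

Section graphs.
Context {R : realType}.
Notation mR := (measurableTypeR R).
Notation mu := (@lebesgue_measure R).

(** The sections of a graph are points. *)
Lemma ae_neq_graph (g : R -> R) : measurable_fun setT (g : mR -> mR) ->
  \forall z \ae (mu \x mu)%E, z.1 != g z.2.
Proof.
move=> mg; pose G := [set z : mR * mR | z.1 = g z.2].
have mG : measurable G.
  have mh : measurable_fun setT (fun z : mR * mR => z.1 - g z.2 : mR).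
    apply: measurable_funB; first exact: measurable_fst.
    exact: (measurableT_comp mg measurable_snd).
  have -> : G = (fun z : mR * mR => z.1 - g z.2 : mR) @^-1` [set 0].
    apply/seteqP; split => z; rewrite /G/=; first by move=> ->; exact: subrr.
    by move=> /eqP; rewrite subr_eq0 => /eqP.
  rewrite -[X in measurable X]setTI; apply: mh => //; exact: measurable_set1.
exists G; split => //; last by move=> z /=; move/negP; rewrite negbK => /eqP.
rewrite product_lebesgueE// integral0_eq// => a _.
have -> : ysection G a = [set g a].
  by apply/seteqP; split => l; rewrite /ysection/= inE.
exact: lebesgue_measure_set1.
Qed.

Lemma ae_product_filter : Filter (almost_everywhere (mu \x mu)%E).
Proof.
exact: (ae_filter_ringOfSetsType
  ((mu \x mu)%E : {measure set (mR * mR) -> \bar R})).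
Qed.

Lemma measurable_eucl_dist (X1 X2 Y1 Y2 : R -> R) :
  measurable_fun setT (X1 : mR -> mR) -> measurable_fun setT (X2 : mR -> mR) ->
  measurable_fun setT (Y1 : mR -> mR) -> measurable_fun setT (Y2 : mR -> mR) ->
  measurable_fun setT ((fun a => eucl_dist (X1 a, X2 a) (Y1 a, Y2 a)) : mR -> mR).
Proof.
move=> m1 m2 m3 m4.
rewrite (_ : (fun a => _) = fun a : mR =>
  Num.sqrt ((Y1 a - X1 a) ^+ 2 + (Y2 a - X2 a) ^+ 2)); last first.
  by apply/funext => a; rewrite eucl_distE.
apply: (@measurableT_comp _ _ _ _ _ _ (@Num.sqrt R : mR -> mR)).
  by apply: continuous_measurable_fun; exact: sqrt_continuous.
by apply: measurable_funD; apply: measurable_funX; exact: measurable_funB.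
Qed.

Lemma rho2'_is_cvg (A u Q Q' : R * R) (a l v : R) :
  rho2_quotient A u a Q Q' l t @[t --> 0^'+] --> v -> rho2'_is A u a Q Q' l v.
Proof. by move=> h; split; [apply/cvg_ex; exists v|exact: cvg_lim h]. Qed.

Lemma dir_surj (u : R * R) : eucl_norm u = 1 -> exists om, u = dir om.
Proof.
move=> u1; have uu : u.1 ^+ 2 + u.2 ^+ 2 = 1.
  have h : 0 <= u.1 ^+ 2 + u.2 ^+ 2 by rewrite addr_ge0 ?sqr_ge0.
  move/(congr1 (fun z => z ^+ 2)): u1; rewrite /eucl_norm /dot -!expr2.
  by rewrite sqr_sqrtr// expr1n.
have u2 : 1 - u.1 ^+ 2 = u.2 ^+ 2 by rewrite -uu; ring.
have ub : -1 <= u.1 <= 1.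
  rewrite -ler_norml -(ler_pXn2r (n := 2))// ?nnegrE// expr1n.
  by rewrite real_normK ?num_real// -subr_ge0 u2 sqr_ge0.
have [p|n] := leP 0 u.2.
  exists (acos u.1); apply: vec_eq; rewrite /dir/= ?sin_acos// ?acosK ?in_itv//=.
  by rewrite u2 sqrtr_sqr ger0_norm.
exists (- acos u.1); apply: vec_eq; rewrite /dir/= ?sinN ?cosN ?sin_acos// ?acosK ?in_itv//=.
by rewrite u2 sqrtr_sqr ltr0_norm// opprK.
Qed.

Lemma eucl_normE (u : R * R) : eucl_norm u ^+ 2 = u.1 ^+ 2 + u.2 ^+ 2.
Proof.
by rewrite /eucl_norm /dot -!expr2 sqr_sqrtr// addr_ge0 ?sqr_ge0.
Qed.

Lemma eucl_normZ (c : R) (u : R * R) : eucl_norm (c *: u) = `|c| * eucl_norm u.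
Proof.
rewrite /eucl_norm /dot !vecE -sqrtr_sqr -sqrtrM ?sqr_ge0//; congr Num.sqrt; ring.
Qed.

Lemma eucl_norm_gt0 (u : R * R) : u != 0 -> 0 < eucl_norm u.
Proof.
move=> u0; rewrite /eucl_norm sqrtr_gt0 /dot -!expr2 lt_neqAle addr_ge0 ?sqr_ge0// andbT.
rewrite eq_sym paddr_eq0 ?sqr_ge0// !sqrf_eq0; apply: contra u0 => /andP[/eqP a /eqP b].
by apply/eqP; apply: vec_eq.
Qed.

Lemma eucl_norm_dir a : eucl_norm (dir a) = 1 :> R.
Proof. by rewrite /eucl_norm /dot/= -!expr2 cos2Dsin2 sqrtr1. Qed.

Lemma eucl_dist_dir (O : R * R) (om x : R) : 0 <= x ->
  eucl_dist O (O + x *: dir om) = x.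
Proof.
move=> x0; rewrite /eucl_dist (_ : O + _ - O = x *: dir om).
  by rewrite eucl_normZ eucl_norm_dir mulr1 ger0_norm.
by apply: vec_eq; rewrite !vecE; ring.
Qed.

End graphs.

Section opposite.
Context {R : realType}.
Notation mR := (measurableTypeR R).
Notation mu := (@lebesgue_measure R).
Variables (A B C D V : R * R) (op : R * R -> R * R).
Hypothesis cvx : convex_quadrilateral A B C D.
Hypotheses (VAC : segment A C V) (VBD : segment B D V).
Hypothesis opP : forall M, segment A B M -> segment C D (op M) /\ line_through M (op M) V.
Let u := (eucl_norm (B - A))^-1 *: (B - A).

Lemma cross_BAC : cross (B - A) (C - A) != 0.
Proof.
case: cvx => s _ _ _; apply/eqP => c0; move: s.
by rewrite /strict_same_side c0 mul0r ltxx.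
Qed.

Lemma norm_AB_gt0 : 0 < eucl_norm (B - A).
Proof.
apply: eucl_norm_gt0; apply/eqP => BA; have /eqP := cross_BAC; apply.
by rewrite BA /cross/= !mul0r subrr.
Qed.

Let point (a : R) := A + a *: u.

Let coef (a : R) : R :=
  - cross (V - point a) (C - point a) / cross (V - point a) (D - C).

Lemma point_segment a : 0 < a < eucl_norm (B - A) -> segment A B (point a).
Proof.
move=> a0; have n0 := norm_AB_gt0; exists (a / eucl_norm (B - A)); split.
  by rewrite divr_ge0/= ?ler_pdivrMr ?mul1r//; lra.
by rewrite /point /u scalerA.
Qed.

(** The coefficient solves a linear equation, as [V] is on the line through
    [point a] and [op (point a)].  It is not [0], because [V] is not [C], which
    is not on the line [BD]. *)
Lemma op_coef a : 0 < a < eucl_norm (B - A) ->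
  op (point a) = C + coef a *: (D - C) /\ 0 < coef a <= 1.
Proof.
move=> a0; have n0 := norm_AB_gt0.
have [[s [s01 opE]] [r Vr]] := opP (point_segment a0).
have [v [v01 VE]] := VAC.
have v1 : v != 1.
  apply/eqP => v1; have VC : V = C by rewrite VE v1 scale1r addrC subrK.
  have [t [_ Vt]] := VBD; have [_ s2 _ _] := cvx; move: s2.
  rewrite /strict_same_side (_ : cross (C - B) (D - B) = 0) ?mul0r ?ltxx//.
  by rewrite -VC Vt /cross !vecE; ring.
have PE : point a = A + (a / eucl_norm (B - A)) *: (B - A) by rewrite /point /u scalerA.
have nE : cross (V - point a) (C - point a) =
    (a / eucl_norm (B - A)) * (v - 1) * cross (B - A) (C - A).
  by rewrite PE VE /cross !vecE; ring.
have n1 : cross (V - point a) (C - point a) != 0.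
  rewrite nE !mulf_neq0 ?cross_BAC ?subr_eq0// ?invr_neq0 ?gt_eqF//; lra.
have se : cross (V - point a) (C - point a) + s * cross (V - point a) (D - C) = 0.
  transitivity (cross (V - point a) (op (point a) - point a)).
    by rewrite opE /cross !vecE; ring.
  by rewrite {1}Vr /cross !vecE; ring.
have e0 : cross (V - point a) (D - C) != 0.
  by apply/eqP => e0; move: se; rewrite e0 mulr0 addr0 => /eqP; rewrite (negbTE n1).
have sE : s = coef a.
  rewrite /coef; apply: (mulIf e0); rewrite divfK//; apply/eqP.
  by rewrite -addr_eq0 addrC se.
split; first by rewrite -sE.
have s0 : s != 0.
  by apply/eqP => s0; move: se; rewrite s0 mul0r addr0 => /eqP; rewrite (negbTE n1).
by rewrite -sE lt_neqAle eq_sym s0/= andbC; case/andP: s01 => -> ->.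
Qed.

(** At these lengths an indicator function of the statement jumps.  There are two
    of them for each [a], and they depend on [a] in a measurable way. *)
Lemma ae_not_extremal_chord : \forall z \ae (mu \x mu)%E,
  0 < z.2 < eucl_norm (B - A) ->
  z.1 != eucl_dist (A + z.2 *: u) C /\ z.1 != eucl_dist (A + z.2 *: u) (op (A + z.2 *: u)).
Proof.
have mlin (c e : R) : measurable_fun setT ((fun a => c + a * e) : mR -> mR).
  by apply: measurable_funD => //; apply: measurable_funM.
have mP1 (X : R * R) : measurable_fun setT ((fun a => (X - point a).1) : mR -> mR).
  by apply: (@measurable_funB _ mR R setT (fun=> X.1) (fun a => A.1 + a * u.1));
    [exact: measurable_cst|exact: mlin].
have mP2 (X : R * R) : measurable_fun setT ((fun a => (X - point a).2) : mR -> mR).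
  by apply: (@measurable_funB _ mR R setT (fun=> X.2) (fun a => A.2 + a * u.2));
    [exact: measurable_cst|exact: mlin].
have mcoef : measurable_fun setT (coef : mR -> mR).
  apply: measurable_funM.
    apply: measurableT_comp => //.
    by apply: measurable_funB; apply: measurable_funM;
      first [exact: mP1|exact: mP2].
  by apply: measurable_fun_inv; apply: measurable_funB; apply: measurable_funM;
    first [exact: mP1|exact: mP2|exact: measurable_cst].
have m1 : measurable_fun setT
    ((fun a => eucl_dist (A.1 + a * u.1, A.2 + a * u.2) (C.1, C.2)) : mR -> mR).
  by apply: measurable_eucl_dist.
have m2 : measurable_fun setT
    ((fun a => eucl_dist (A.1 + a * u.1, A.2 + a * u.2)
      (C.1 + coef a * (D - C).1, C.2 + coef a * (D - C).2)) : mR -> mR).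
  apply: measurable_eucl_dist => //.
    by apply: measurable_funD => //; apply: measurable_funM.
  by apply: measurable_funD => //; apply: measurable_funM.
apply: (@filterS2 _ _ ae_product_filter) (ae_neq_graph m1) (ae_neq_graph m2) =>
  -[l a] /= h1 h2 a0.
have pE : (A.1 + a * u.1, A.2 + a * u.2) = A + a *: u by exact: vec_eq.
have [oE _] := op_coef a0.
rewrite /point in oE; rewrite oE -pE; split.
  by move: h1; rewrite -surjective_pairing.
by move: h2; congr (_ != eucl_dist _ _); apply: vec_eq.
Qed.

End opposite.

(** * The two positions of the opposite sides *)

Section wedge_derivative.
Context {R : realType}.

(** Here [om] is the direction of [Q], and [k] is the orientation of the angle
    from [Q] to [P]. *)
Lemma wedge_frame (P Q : R * R) : cross P Q != 0 ->
  let ga := acos (dot P Q / (eucl_norm P * eucl_norm Q)) in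
  0 < ga < pi /\ exists om k, [/\ `|k| = 1,
    P = eucl_norm P *: dir (om + k * ga) & Q = eucl_norm Q *: dir om].
Proof.
move=> PQ0 ga.
have p0 : 0 < eucl_norm P.
  apply: eucl_norm_gt0; apply/eqP => P0; move: PQ0.
  by rewrite P0 /cross/= !mul0r subrr eqxx.
have q0 : 0 < eucl_norm Q.
  apply: eucl_norm_gt0; apply/eqP => Q0; move: PQ0.
  by rewrite Q0 /cross/= !mulr0 subrr eqxx.
set p := eucl_norm P in p0 *; set q := eucl_norm Q in q0 *.
have [om omE] : exists om, q^-1 *: Q = dir om.
  apply: dir_surj; rewrite eucl_normZ gtr0_norm ?invr_gt0//.
  by rewrite mulVf// gt_eqF.
have QE : Q = q *: dir om by rewrite -omE scalerA mulfV ?scale1r// gt_eqF.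
pose u1 := p^-1 *: P.
have PE : P = p *: u1 by rewrite /u1 scalerA mulfV ?scale1r// gt_eqF.
have u11 : u1.1 ^+ 2 + u1.2 ^+ 2 = 1.
  rewrite -eucl_normE /u1 eucl_normZ gtr0_norm ?invr_gt0//.
  by rewrite mulVf ?expr1n// gt_eqF.
have u22 := cos2Dsin2 om.
pose c := dot u1 (dir om); pose s := cross (dir om) u1.
have cs : c ^+ 2 + s ^+ 2 = 1.
  transitivity ((u1.1 ^+ 2 + u1.2 ^+ 2) * (cos om ^+ 2 + sin om ^+ 2)).
    by rewrite /c /s /dot /cross/=; ring.
  by rewrite u11 u22 mulr1.
have gaE : ga = acos c.
  rewrite /ga -/p -/q; congr acos; rewrite /c -omE /u1 /dot !vecE.
  by field; rewrite !gt_eqF.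
have s0 : s != 0.
  apply: contraNneq PQ0 => s0; rewrite QE PE.
  have -> : cross (p *: u1) (q *: dir om) = - (p * q * s).
    by rewrite /s /cross !vecE; ring.
  by rewrite s0 mulr0 oppr0.
have s2 : 0 < s ^+ 2 by rewrite lt_neqAle sqr_ge0 andbT eq_sym expf_neq0.
have c1 : -1 < c < 1.
  rewrite -ltr_norml -(ltr_pXn2r (n := 2))// ?nnegrE// expr1n real_normK ?num_real//.
  by rewrite -cs ltrDl.
have gab : 0 < ga < pi.
  by rewrite gaE acos_gt0 ?acos_ltpi//; lra.
split => //; exists om, (Num.sg s); split => //.
  by rewrite normr_sg s0.
have k1 : `|Num.sg s| = 1 by rewrite normr_sg s0.
have sga : sin (Num.sg s * ga) = s.
  rewrite (sin_unit_mul k1) gaE sin_acos; last lra.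
  have -> : 1 - c ^+ 2 = s ^+ 2 by rewrite -cs; ring.
  by rewrite sqrtr_sqr mulr_sg_norm.
have cga : cos (Num.sg s * ga) = c.
  by rewrite (cos_unit_mul k1) gaE acosK// in_itv/=; lra.
rewrite {1}PE; congr (_ *: _); apply: vec_eq; rewrite /dir/= ?cosD ?sinD sga cga.
  transitivity (u1.1 * (cos om ^+ 2 + sin om ^+ 2)); first by rewrite u22 mulr1.
  by rewrite /c /s /dot /cross/=; ring.
transitivity (u1.2 * (cos om ^+ 2 + sin om ^+ 2)); first by rewrite u22 mulr1.
by rewrite /c /s /dot /cross/=; ring.
Qed.

Lemma rho2_wedge (O A : R * R) (om k ga a x y1 y2 l : R) :
  let u1 := dir (om + k * ga) in let u2 := dir om in
  `|k| = 1 -> 0 < ga < pi -> 0 < x -> 0 < y1 -> y1 < y2 -> 0 < l ->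
  A + a *: - u1 = O + x *: u1 ->
  l != eucl_dist (O + x *: u1) (O + y1 *: u2) ->
  l != eucl_dist (O + x *: u1) (O + y2 *: u2) ->
  let ym := sin (asin (x / l * sin ga) - ga) / sin ga * l in
  let yp := sin (asin (x / l * sin ga) + ga) / sin ga * l in
  let K := x * sin ga / (l * Num.sqrt (l ^+ 2 - x ^+ 2 * sin ga ^+ 2)) in
  (l < x * sin ga -> rho2'_is A (- u1) a (O + y1 *: u2) (O + y2 *: u2) l 0) /\
  (x * sin ga < l -> rho2'_is A (- u1) a (O + y1 *: u2) (O + y2 *: u2) l
     (\1_`[y1, y2] ym * K * sin (asin (x / l * sin ga) - ga) +
      \1_`[y1, y2] yp * K * sin (asin (x / l * sin ga) + ga))).
Proof.
move=> u1 u2 k1 ga0 x0 y1_gt0 y12 l0 ME n1 n2 ym yp K.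
have sga : 0 < sin ga by exact: sin_gt0_pi.
have near_rho : \forall t \near (0 : R)^'+,
    t^-1 * wedge_density ga (x - t) x y1 y2 l =
    rho2_quotient A (- u1) a (O + y1 *: u2) (O + y2 *: u2) l t.
  near=> t.
  have t0 : 0 < t by near: t; exact: nbhs_right_gt.
  have tx : t < x by near: t; exact: nbhs_right_lt.
  rewrite /rho2_quotient ME.
  have -> : A + (a + t) *: - u1 = O + (x - t) *: u1.
    transitivity (A + a *: - u1 + t *: - u1); first by apply: vec_eq; rewrite !vecE; ring.
    by rewrite ME; apply: vec_eq; rewrite !vecE; ring.
  by rewrite rho_wedge//; lra.
split=> [lx|xl]; apply: rho2'_is_cvg.
  apply: cvg_trans (near_eq_cvg near_rho) _.
  exact: cvg_wedge_density_lt.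
set s0 := asin (x / l * sin ga).
have s0E : asin ((x - 0) * sin ga / l) = s0.
  by rewrite /s0 subr0; congr asin; ring.
have c0 : 0 < x / l * sin ga < 1.
  rewrite mulr_gt0 ?divr_gt0//= mulrAC ltr_pdivrMr// mul1r.
  by rewrite xl.
have ss : sin s0 = x / l * sin ga by rewrite /s0 asinK// in_itv/=; lra.
have xE : x = l * sin s0 / sin ga by rewrite ss; field; rewrite !gt_eqF.
have sp : sin (pi - s0) = sin s0 by rewrite sinB sinpi cospi; ring.
have spg : sin (pi - s0 - ga) = sin (s0 + ga).
  have -> : pi - s0 - ga = pi - (s0 + ga) by ring.
  by rewrite sinB sinpi cospi; ring.
(* By the law of sines, the ends y- and y+ of the statement are at the distance
   l, so they differ from the ends of the second segment. *)
have law b : sin b = sin s0 ->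
    eucl_dist (O + x *: u1) (O + (l * sin (b - ga) / sin ga) *: u2) = l.
  move=> bs; rewrite (wedge_dist _ _ _ k1) xE -bs.
  rewrite -[RHS](gtr0_norm l0) -sqrtr_sqr; congr Num.sqrt.
  transitivity (l ^+ 2 / sin ga ^+ 2 * (sin (b - ga) ^+ 2 + sin b ^+ 2
    - sin b * sin (b - ga) * cos ga *+ 2)); first by field; rewrite gt_eqF.
  by rewrite sin_triangle divfK// expf_neq0// gt_eqF.
have neq b y : sin b = sin s0 -> l != eucl_dist (O + x *: u1) (O + y *: u2) ->
    l * sin (b - ga) / sin ga != y.
  by move=> /law bl; apply: contraNneq => <-; rewrite bl.
have := @cvg_wedge_density_gt R ga x y1 y2 l ga0 x0 y1_gt0 l0 xl.
rewrite s0E -spg => /(_ (neq _ _ erefl n1) (neq _ _ erefl n2) (neq _ _ sp n1) (neq _ _ sp n2)).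
rewrite spg => lim.
set v := (X in _ --> X) in lim.
rewrite (_ : _ + _ = v).
  exact: cvg_trans (near_eq_cvg near_rho) lim.
rewrite /v /ym /yp -/s0 /wedge_weight spg sp !indicE.
have -> : (sin (s0 - ga) / sin ga * l \in (`[y1, y2]%classic : set R)) =
    (y1 <= l * sin (s0 - ga) / sin ga <= y2).
  rewrite (_ : _ / _ * _ = l * sin (s0 - ga) / sin ga); last by ring.
  by apply/idP/idP; rewrite inE/= in_itv.
have -> : (sin (s0 + ga) / sin ga * l \in (`[y1, y2]%classic : set R)) =
    (y1 <= l * sin (s0 + ga) / sin ga <= y2).
  rewrite (_ : _ / _ * _ = l * sin (s0 + ga) / sin ga); last by ring.
  by apply/idP/idP; rewrite inE/= in_itv.
rewrite ss /K exprMn; have q0 : 0 < Num.sqrt (l ^+ 2 - x ^+ 2 * sin ga ^+ 2).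
  rewrite sqrtr_gt0 -exprMn subr_gt0 ltrXn2r// mulr_ge0 ?ltW//.
by field; rewrite !gt_eqF.
Unshelve. all: by end_near. Qed.

End wedge_derivative.

Section strip_derivative.
Context {R : realType}.

Lemma rho2_strip (B A : R * R) (om k d a x y1 y2 l : R) :
  let w := dir om in let H := B + (k * d) *: dir (om + pi / 2) in
  `|k| = 1 -> 0 < d -> y1 <= y2 -> 0 < l ->
  A + a *: - w = B + x *: w ->
  l != eucl_dist (B + x *: w) (H + y1 *: w) ->
  l != eucl_dist (B + x *: w) (H + y2 *: w) ->
  let ym := x - Num.sqrt (l ^+ 2 - d ^+ 2) in
  let yp := x + Num.sqrt (l ^+ 2 - d ^+ 2) in
  (l < d -> rho2'_is A (- w) a (H + y1 *: w) (H + y2 *: w) l 0) /\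
  (d < l -> rho2'_is A (- w) a (H + y1 *: w) (H + y2 *: w) l
     ((\1_`[y1, y2] ym + \1_`[y1, y2] yp) *
      (d ^+ 2 / (l ^+ 2 * Num.sqrt (l ^+ 2 - d ^+ 2))))).
Proof.
move=> w H k1 d0 y12 l0 ME n1 n2 ym yp.
have near_rho : l != d -> \forall t \near (0 : R)^'+,
    t^-1 * strip_density d (x - t) x y1 y2 l =
    rho2_quotient A (- w) a (H + y1 *: w) (H + y2 *: w) l t.
  move=> ld; near=> t.
  have t0 : 0 < t by near: t; exact: nbhs_right_gt.
  rewrite /rho2_quotient ME.
  have -> : A + (a + t) *: - w = B + (x - t) *: w.
    transitivity (A + a *: - w + t *: - w); first by apply: vec_eq; rewrite !vecE; ring.
    by rewrite ME; apply: vec_eq; rewrite !vecE; ring.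
  by rewrite rho_strip//; lra.
split=> [ld|dl]; apply: rho2'_is_cvg.
  apply: cvg_trans (near_eq_cvg (near_rho _)) _; first by rewrite lt_eqF.
  exact: cvg_strip_density_lt.
have r2 : Num.sqrt (l ^+ 2 - d ^+ 2) ^+ 2 = l ^+ 2 - d ^+ 2.
  by rewrite sqr_sqrtr// subr_ge0 lerXn2r// ?nnegrE ltW.
have law y : y = ym \/ y = yp -> eucl_dist (B + x *: w) (H + y *: w) = l.
  move=> yE; rewrite strip_dist// -[RHS](gtr0_norm l0) -sqrtr_sqr; congr Num.sqrt.
  have -> : (y - x) ^+ 2 = l ^+ 2 - d ^+ 2.
    by rewrite -r2; case: yE => ->; rewrite /ym /yp; ring.
  by ring.
have neq y z : y = ym \/ y = yp -> l != eucl_dist (B + x *: w) (H + z *: w) -> y != z.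
  by move=> /law yl; apply: contraNneq => <-; rewrite yl.
have lim := @cvg_strip_density_gt R d y1 y2 x l dl y12
  (neq _ _ (or_intror erefl) n1) (neq _ _ (or_intror erefl) n2)
  (neq _ _ (or_introl erefl) n1) (neq _ _ (or_introl erefl) n2).
set v := (X in _ --> X) in lim.
have ld : l != d by rewrite gt_eqF.
rewrite (_ : (_ + _) * _ = v); first exact: cvg_trans (near_eq_cvg (near_rho ld)) lim.
rewrite /v -/yp -/ym /strip_kernel mulrC addrC !indicE; congr (_ * _).
have inY z : (z \in (`[y1, y2]%classic : set R)) = (y1 <= z <= y2).
  by apply/idP/idP; rewrite inE/= in_itv.
by rewrite !inY addrC.
Unshelve. all: by end_near. Qed.

End strip_derivative.

Theorem proposition9p2 (R : realType) (A B C D V : R * R)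
    (op : R * R -> R * R) :
  convex_quadrilateral A B C D ->
  segment A C V -> segment B D V ->
  (forall M, segment A B M ->
     segment C D (op M) /\ line_through M (op M) V) ->
  let u := (eucl_norm (B - A))^-1 *: (B - A) in
  (forall O : R * R, lines_meet_beyond_BC A B C D O ->
     let gamma := angle A O D in
     \forall z \ae (lebesgue_measure \x lebesgue_measure)%E,
       let l : R := z.1 in
       let a : R := z.2 in
       0 < l -> 0 < a < eucl_norm (B - A) ->
       let M := A + a *: u in
       let x := eucl_dist O M in
       let y1 := eucl_dist O C in
       let y2 := eucl_dist O (op M) in
       let ym := sin (asin (x / l * sin gamma) - gamma) / sin gamma * l in
       let yp := sin (asin (x / l * sin gamma) + gamma) / sin gamma * l in
       let K := x * sin gamma /
                (l * Num.sqrt (l ^+ 2 - x ^+ 2 * sin gamma ^+ 2)) in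
       (l < x * sin gamma -> rho2'_is A u a C (op M) l 0) /\
       (x * sin gamma < l ->
          rho2'_is A u a C (op M) l
            (\1_`[y1, y2] ym * K * sin (asin (x / l * sin gamma) - gamma) +
             \1_`[y1, y2] yp * K * sin (asin (x / l * sin gamma) + gamma))))
  /\
  (parallel A B C D ->
     let d := set_dist (line_through A B) (line_through C D) in
     let w := (eucl_norm (A - B))^-1 *: (A - B) in
     forall H : R * R, line_through C D H -> dot (H - B) (D - C) = 0 ->
     \forall z \ae (lebesgue_measure \x lebesgue_measure)%E,
       let l : R := z.1 in
       let a : R := z.2 in
       0 < l -> 0 < a < eucl_norm (B - A) ->
       let M := A + a *: u in
       let x := dot (M - B) w in
       let y1 := dot (C - H) w in
       let y2 := dot (op M - H) w in
       let ym := x - Num.sqrt (l ^+ 2 - d ^+ 2) in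
       let yp := x + Num.sqrt (l ^+ 2 - d ^+ 2) in
       (l < d -> rho2'_is A u a C (op M) l 0) /\
       (d < l ->
          rho2'_is A u a C (op M) l
            ((\1_`[y1, y2] ym + \1_`[y1, y2] yp) *
             (d ^+ 2 / (l ^+ 2 * Num.sqrt (l ^+ 2 - d ^+ 2)))))).
Proof.
move=> cvx VAC VBD opP u.
have BAC := cross_BAC cvx.
have nAB := norm_AB_gt0 cvx.
have aeP := ae_not_extremal_chord cvx VAC VBD opP.
split=> [ O [_ _ [be [be01 BE]] [de [de01 CE]]] gamma|par d w H [th HE] Hperp].
  have cAD : cross (A - O) (D - O) != 0.
    apply: contraNneq BAC => c0.
    have -> : cross (B - A) (C - A) = - ((1 - be) * de * cross (A - O) (D - O)).
      by rewrite BE CE /cross !vecE; ring.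
    by rewrite c0 mulr0 oppr0.
  have [ga0 [om [k [k1 PE QE]]]] := wedge_frame cAD.
  rewrite -/(angle A O D) -/gamma in ga0 PE.
  set p := eucl_norm (A - O) in PE; set q := eucl_norm (D - O) in QE.
  have p0 : 0 < p.
    by apply: eucl_norm_gt0; apply: contraNneq cAD => ->; rewrite /cross/= !mul0r subrr.
  have q0 : 0 < q.
    by apply: eucl_norm_gt0; apply: contraNneq cAD => ->; rewrite /cross/= !mulr0 subrr.
  have AE : A = O + p *: dir (om + k * gamma) by rewrite -PE addrC subrK.
  have DE : D = O + q *: dir om by rewrite -QE addrC subrK.
  have BAE : B - A = - (1 - be) *: (A - O).
    by rewrite BE; apply: vec_eq; rewrite !vecE; ring.
  have nBA : eucl_norm (B - A) = (1 - be) * p.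
    by rewrite BAE eucl_normZ normrN gtr0_norm//; lra.
  have uE : u = - dir (om + k * gamma).
    rewrite /u nBA BAE PE !scalerA -[RHS]scaleN1r; congr (_ *: _).
    by field; rewrite !gt_eqF//; lra.
  have C1 : C = O + (de * q) *: dir om by rewrite CE QE scalerA.
  apply: (@filterS _ _ ae_product_filter _ _ _ aeP) => -[l a] /= h l0 a0.
  have [nC nop] := h a0.
  have [s [oE co]] : exists s, op (A + a *: u) = C + s *: (D - C) /\ 0 < s <= 1.
    exact: (ex_intro _ _ (op_coef cvx VAC VBD opP a0)).
  pose x := p - a; pose y1 := de * q; pose y2 := de * q + s * ((1 - de) * q).
  have x0 : 0 < x.
    have : 0 < be * p by rewrite mulr_gt0//; lra.
    by rewrite /x; move: a0; rewrite nBA; lra.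
  have y1_gt0 : 0 < y1 by rewrite mulr_gt0//; lra.
  have y12 : y1 < y2.
    have s0 : 0 < s by case/andP: co.
    by rewrite ltrDl !mulr_gt0//; lra.
  have ME : A + a *: u = O + x *: dir (om + k * gamma).
    by rewrite uE AE /x; apply: vec_eq; rewrite !vecE; ring.
  have opE : op (A + a *: u) = O + y2 *: dir om.
    by rewrite oE C1 DE /y2; apply: vec_eq; rewrite !vecE; ring.
  rewrite opE ME C1 -/y1 in nC nop *.
  rewrite !eucl_dist_dir ?(ltW x0) ?(ltW y1_gt0) ?(ltW (lt_trans y1_gt0 y12))// uE.
  by apply: rho2_wedge => //; rewrite -uE.
have n0 : 0 < eucl_norm (A - B).
  by rewrite (_ : A - B = -1 *: (B - A)) ?eucl_normZ ?normrN1 ?mul1r//;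
    apply: vec_eq; rewrite !vecE; ring.
have nE : eucl_norm (B - A) = eucl_norm (A - B).
  rewrite [in LHS](_ : B - A = -1 *: (A - B)) ?eucl_normZ ?normrN1 ?mul1r//.
  by apply: vec_eq; rewrite !vecE; ring.
set n := eucl_norm (A - B) in n0 nE.
have [om wE] : exists om, w = dir om.
  by apply: dir_surj; rewrite eucl_normZ gtr0_norm ?invr_gt0// mulVf// gt_eqF.
have AE : A = B + n *: w.
  by rewrite /w scalerA mulfV ?scale1r ?gt_eqF// addrC subrK.
have uE : u = - w by rewrite /u nE /w; apply: vec_eq; rewrite !vecE; ring.
have w1 : w.1 ^+ 2 + w.2 ^+ 2 = 1 by rewrite wE cos2Dsin2.
clearbody w.
pose c := dot (D - C) w.
have cDw : cross w (D - C) = 0.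
  have : cross (B - A) (D - C) = 0 by exact: par.
  rewrite AE (_ : cross _ _ = - n * cross w (D - C)); last first.
    by rewrite /cross !vecE; ring.
  by move/eqP; rewrite mulf_eq0 oppr_eq0 gt_eqF//= => /eqP.
have DE : D - C = c *: w.
  apply: vec_eq; rewrite /c !vecE.
    transitivity ((w.1 ^+ 2 + w.2 ^+ 2) * (D.1 - C.1) + w.2 * cross w (D - C)).
      by rewrite w1 cDw mulr0 addr0 mul1r.
    by rewrite /dot /cross !vecE; ring.
  transitivity ((w.1 ^+ 2 + w.2 ^+ 2) * (D.2 - C.2) - w.1 * cross w (D - C)).
    by rewrite w1 cDw mulr0 subr0 mul1r.
  by rewrite /dot /cross !vecE; ring.
have D1 : D = C + c *: w by rewrite -DE addrC subrK.
have cCw : cross w (C - B) != 0.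
  apply: contraNneq BAC => c0.
  have -> : cross (B - A) (C - A) = - n * cross w (C - B).
    by rewrite AE /cross !vecE; ring.
  by rewrite c0 mulr0.
(* The convexity at the side BC forces CD to be oriented like BA. *)
have c_gt0 : 0 < c.
  have [_ s2 _ _] := cvx; move: s2; rewrite /strict_same_side.
  have -> : cross (C - B) (D - B) * cross (C - B) (A - B) =
      c * (n * cross w (C - B) ^+ 2).
    by rewrite D1 AE /cross !vecE; ring.
  rewrite pmulr_lgt0// mulr_gt0// lt_neqAle sqr_ge0 andbT eq_sym.
  by rewrite expf_neq0.
have HBw : dot (H - B) w = 0.
  move: Hperp; rewrite DE (_ : dot _ (c *: w) = c * dot (H - B) w); last first.
    by rewrite /dot !vecE; ring.
  by move/eqP; rewrite mulf_eq0 gt_eqF//= => /eqP.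
pose hh := cross w (H - B).
have hh0 : hh != 0.
  rewrite /hh HE DE (_ : cross _ _ = cross w (C - B))//.
  by rewrite /cross !vecE; ring.
have k1 : `|Num.sg hh| = 1 by rewrite normr_sg hh0.
have HB : H = B + (Num.sg hh * `|hh|) *: dir (om + pi / 2).
  have -> : H = B + (H - B) by rewrite addrC subrK.
  congr (_ + _); rewrite mulr_sg_norm.
  apply: vec_eq; rewrite /dir !vecE/= ?cosDpihalf ?sinDpihalf.
    have -> : sin om = w.2 by rewrite wE.
    transitivity ((w.1 ^+ 2 + w.2 ^+ 2) * (H.1 - B.1) - w.1 * dot (H - B) w).
      by rewrite w1 HBw mulr0 subr0 mul1r.
    by rewrite /hh /dot /cross !vecE; ring.
  have -> : cos om = w.1 by rewrite wE.
  transitivity ((w.1 ^+ 2 + w.2 ^+ 2) * (H.2 - B.2) - w.2 * dot (H - B) w).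
    by rewrite w1 HBw mulr0 subr0 mul1r.
  by rewrite /hh /dot /cross !vecE; ring.
have CH : C = H + dot (C - H) w *: w.
  have -> : C - H = (- (th * c)) *: w.
    by rewrite HE DE; apply: vec_eq; rewrite !vecE; ring.
  have -> : dot (- (th * c) *: w) w = - (th * c) * (w.1 ^+ 2 + w.2 ^+ 2).
    by rewrite /dot !vecE; ring.
  by rewrite w1 mulr1 HE DE; apply: vec_eq; rewrite !vecE; ring.
set y1 := dot (C - H) w in CH *.
have d_gt0 : 0 < `|hh| by rewrite normr_gt0.
have dE : d = `|hh|.
  transitivity (set_dist (line_through (B + n *: dir om) (B + 0 *: dir om))
    (line_through (B + (Num.sg hh * `|hh|) *: dir (om + pi / 2) + y1 *: dir om)
      (B + (Num.sg hh * `|hh|) *: dir (om + pi / 2) + (y1 + c) *: dir om))).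
    rewrite -HB -wE scale0r addr0 -AE -CH; congr (set_dist _ (line_through _ _)).
    by rewrite {1}D1 {1}CH; apply: vec_eq; rewrite !vecE; ring.
  by apply: set_dist_strip => //; rewrite gt_eqF.
apply: (@filterS _ _ ae_product_filter _ _ _ aeP) => -[l a] /= h l0 a0.
have [nC nop] := h a0.
have [s [oE co]] : exists s, op (A + a *: u) = C + s *: (D - C) /\ 0 < s <= 1.
  exact: (ex_intro _ _ (op_coef cvx VAC VBD opP a0)).
pose x := n - a; pose y2 := y1 + s * c.
have ME : A + a *: u = B + x *: w.
  by rewrite uE AE /x; apply: vec_eq; rewrite !vecE; ring.
have opE : op (A + a *: u) = H + y2 *: w.
  have -> : op (A + a *: u) = H + y1 *: w + s *: (c *: w) by rewrite oE DE -CH.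
  by rewrite /y2; apply: vec_eq; rewrite !vecE; ring.
have y12 : y1 <= y2 by rewrite lerDl mulr_ge0 ?ltW//; lra.
have dotw (P : R * R) (z : R) : dot (P + z *: w - P) w = z.
  transitivity (z * (w.1 ^+ 2 + w.2 ^+ 2)); last by rewrite w1 mulr1.
  by rewrite /dot !vecE; ring.
have xE : dot (A + a *: u - B) w = x by rewrite ME dotw.
have y2E : dot (op (A + a *: u) - H) w = y2 by rewrite opE dotw.
rewrite /= xE y2E opE dE.
have := @rho2_strip R B A om (Num.sg hh) `|hh| a x y1 y2 l.
rewrite /= -HB -wE -uE -CH; apply => //.
- by rewrite -ME.
- by rewrite -ME -opE.
Qed.
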